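(* Let $\Phi$ be an irreducible root system of rank $\ell$ with a fixed simple system $\Delta=\{\alpha_1,\dots,\alpha_\ell\}$ and set of positive roots $\Phi^+$. Suppose that $\Phi^+=\{\beta_1,\beta_2,\dots,\beta_s\}$ (with $s=|\Phi^+|$) is enumerated so that $\mathrm{ht}(\beta_1)\le\mathrm{ht}(\beta_2)\le\cdots\le\mathrm{ht}(\beta_s)$, and put $\Phi_t:=\{\beta_1,\dots,\beta_t\}$ for $1\le t\le s$. Then for every $1\le t\le s$ the arrangement $\mathcal{A}(\Phi_t)=\{H_\alpha\mid\alpha\in\Phi_t\}$ is free with exponents $\mathcal{DP}(\Phi_t)$.
   Context: $\Phi$ is a finite reduced crystallographic root system spanning the $\ell$-dimensional real Euclidean space $V$. The height of $\alpha=\sum_{i=1}^\ell c_i\alpha_i\in\Phi^+$ is $\mathrm{ht}(\alpha)=\sum_{i=1}^\ell c_i$. $H_\alpha\subset V$ is the hyperplane orthogonal to $\alpha$. Height distribution and dual partition: for a nonempty subset $I\subseteq\Phi^+$ of the kind considered (here $I=\Phi_t$), let $m=\max\{\mathrm{ht}(\alpha)\mid\alpha\in I\}$ and $i_j=|\{\alpha\in I\mid \mathrm{ht}(\alpha)=j\}|$ for $1\le j\le m$. The height distribution in $I$ is $(i_1,\dots,i_m)$, and its dual partition is the multiset of $\ell$ integers $$\mathcal{DP}(I)=\big((0)^{\ell-i_1},(1)^{i_1-i_2},\dots,(m-1)^{i_{m-1}-i_m},(m)^{i_m}\big),$$ where $(a)^b$ means that the integer $a$ appears exactly $b$ times. That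 the multiplicities are nonnegative is understood as part of what is asserted. Free arrangements: an arrangement $\mathcal{A}$ in an $\ell$-dimensional vector space $V$ over a field $k$ is a finite set of linear hyperplanes. Let $S=S(V^* )$ be the symmetric algebra of $V^*$, let $\mathrm{Der}\,S$ be the module of $k$-linear derivations $S\to S$, and let $\alpha_H\in V^*$ be a defining linear form of $H\in\mathcal{A}$. Put $D(\mathcal{A})=\{\theta\in\mathrm{Der}\,S\mid \theta(\alpha_H)\in\alpha_HS\text{ for all }H\in\mathcal{A}\}$. $\mathcal{A}$ is free with exponents $(d_1,\dots,d_\ell)$ (regarded as a multiset) if $D(\mathcal{A})$ is a free $S$-module with a homogeneous basis $\theta_1,\dots,\theta_\ell$ such that $\deg\theta_i=d_i$. Here $\theta$ is homogeneous of degree $d$ if $\theta(x)$ is homogeneous of polynomial degree $d$ (or zero) for every $x\in V^*$. *)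

(* Defs.v *)
From mathcomp Require Import all_boot all_order all_algebra.
From mathcomp Require Import reals.
From mathcomp Require Import mpoly.

Set Implicit Arguments.
Unset Strict Implicit.
Unset Printing Implicit Defensive.

Import Order.TTheory GRing.Theory Num.Theory.
Local Open Scope ring_scope.

(* Finite sets of vectors or of hyperplanes are represented by sequences, of
   which only membership matters, except in [height_count], which counts
   correctly only on duplicate-free sequences. *)

Section Arrangements.
Variables (k : fieldType) (l : nat).

(* V is k^l, and S(V^* ) is {mpoly k[l]}: the variable 'X_i is the i-th
   coordinate function, and V^* is the space of 1-homogeneous polynomials. *)
Notation V := 'rV[k]_l.
Notation S := {mpoly k[l]}.

Definition is_arrangement (A : seq {vspace V}) : Prop :=
  forall H, H \in A -> (\dim H).+1 = l.

(* For a hyperplane H this forces p != 0, so that p is unique up to a nonzero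
   scalar. *)
Definition defining_form (H : {vspace V}) (p : S) : Prop :=
  p \is 1.-homog /\ forall v : V, (v \in H) = (p.@[fun i => v 0 i] == 0).

Definition is_derivation (theta : S -> S) : Prop :=
  linear theta /\ forall p q : S, theta (p * q) = theta p * q + p * theta q.

(* D(A); the condition does not depend on the choice of the form p. *)
Definition in_D (A : seq {vspace V}) (theta : S -> S) : Prop :=
  is_derivation theta /\
  forall H p, H \in A -> defining_form H p -> exists q : S, theta p = p * q.

Definition homogeneous_der (d : nat) (theta : S -> S) : Prop :=
  forall x : S, x \is 1.-homog -> theta x \is d.-homog.

Definition is_basis_D (A : seq {vspace V}) (theta : 'I_l -> S -> S) : Prop :=
  [/\ forall i, in_D A (theta i),
      forall eta, in_D A eta ->
        exists c : 'I_l -> S, forall p, eta p = \sum_i c i * theta i p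
    & forall c : 'I_l -> S,
        (forall p, \sum_i c i * theta i p = 0) -> forall i, c i = 0].

Definition free_with_exponents (A : seq {vspace V}) (d : seq nat) : Prop :=
  is_arrangement A /\
  exists (theta : 'I_l -> S -> S) (e : l.-tuple nat),
    [/\ is_basis_D A theta,
        forall i, homogeneous_der (tnth e i) (theta i)
      & perm_eq e d].

End Arrangements.

Section RootSystems.
Variables (R : realType) (l : nat).
Notation V := 'rV[R]_l.

Definition dot (u v : V) : R := \sum_i u 0 i * v 0 i.

Definition cartan (b a : V) : R := 2 * dot b a / dot a a.

Definition is_root_system (Phi : seq V) : Prop :=
  [/\ <<Phi>>%VS = fullv,
      0 \notin Phi,
      forall (a : V) (c : R), a \in Phi -> c *: a \in Phi -> c = 1 \/ c = -1,
      forall a b, a \in Phi -> b \in Phi -> b - cartan b a *: a \in Phi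
    & forall a b, a \in Phi -> b \in Phi -> cartan b a \is a Num.int].

Definition is_irreducible (Phi : seq V) : Prop :=
  Phi != [::] /\
  forall P : pred V,
    (forall a b, a \in Phi -> b \in Phi -> P a -> ~~ P b -> dot a b = 0) ->
    {in Phi, forall a, P a} \/ {in Phi, forall a, ~~ P a}.

Definition is_simple_system (Phi : seq V) (Delta : l.-tuple V) : Prop :=
  [/\ basis_of fullv Delta,
      {subset Delta <= Phi}
    & forall a, a \in Phi ->
        (forall i, coord Delta i a \is a Num.nat) \/
        (forall i, - coord Delta i a \is a Num.nat)].

Definition positive_roots (Phi : seq V) (Delta : l.-tuple V) : seq V :=
  [seq a <- Phi | [forall i, 0 <= coord Delta i a]].

(* The coordinates of a positive root are natural numbers, so the truncation
   is exact. *)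
Definition ht (Delta : l.-tuple V) (a : V) : nat :=
  (\sum_(i < l) Num.truncn (coord Delta i a))%N.

Definition hyperplane_of (a : V) : {vspace V} :=
  lker (linfun (@mulmxr R 1 l 1 a^T)).

Lemma mem_hyperplane_of (a v : V) : (v \in hyperplane_of a) = (dot a v == 0).
Proof.
rewrite memv_ker lfunE /=; apply/eqP/eqP => [/matrixP/(_ 0 0)|av0].
  by rewrite !mxE => <-; apply: eq_bigr => i _; rewrite mxE mulrC.
apply/matrixP => i j; rewrite !ord1 !mxE -[RHS]av0.
by apply: eq_bigr => m _; rewrite mxE mulrC.
Qed.

Definition root_arrangement (I : seq V) : seq {vspace V} :=
  [seq hyperplane_of a | a <- I].

Definition max_height (Delta : l.-tuple V) (I : seq V) : nat :=
  (\max_(a <- I) ht Delta a)%N.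

Definition height_count (Delta : l.-tuple V) (I : seq V) (j : nat) : nat :=
  count (fun a => ht Delta a == j) I.

(* The multiplicities l - i_1, i_1 - i_2, ..., i_(m-1) - i_m are nonnegative. *)
Definition dual_partition_defined (Delta : l.-tuple V) (I : seq V) : Prop :=
  (height_count Delta I 1 <= l)%N /\
  forall j, (1 <= j < max_height Delta I)%N ->
    (height_count Delta I j.+1 <= height_count Delta I j)%N.

Definition dual_partition (Delta : l.-tuple V) (I : seq V) : seq nat :=
  let m := max_height Delta I in
  let n := height_count Delta I in
  nseq (l - n 1%N) 0%N
  ++ flatten [seq nseq (n j - n j.+1)%N j | j <- iota 1 m.-1]
  ++ nseq (n m) m.

End RootSystems.

(* Main.v *)
From HB Require Import structures.
Require Import Defs.
From mathcomp Require Import all_boot all_order all_algebra.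
From mathcomp Require Import reals.
From mathcomp Require Import mpoly.
From mathcomp Require Import ring lra.

(** The sets in question are built by adding, one height at a time, all (at the
    last height, some) of the positive roots of that height, so it suffices to
    understand one such step. Let [T] be the set of positive roots of height at
    most [h], with [A(T)] free and all exponents at most [h], and let [N] be a
    set of roots of height [h + 1]. The multiple addition theorem
    ([multiple_addition]) says that [A(T ++ N)] is again free, and that passing
    to it turns [size N] exponents equal to [h] into [h + 1]; in particular
    there are at least that many exponents [h]. Iterating this from the empty
    arrangement, whose exponents are all [0], produces exactly the dual
    partition of the height distribution, and shows that it is well defined.

    The multiple addition theorem reduces to Gaussian elimination. For a new
    root [a], the restrictions to the hyperplane of [a] of the polynomials
    [theta (lform a)], [theta] in [D(A(T))], are all multiples of one polynomial
    [b] of degree at least [h] ([value_bound]). Hence a basis element of degree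
    less than [h] automatically preserves the ideal of [lform a], and one of
    degree [h] does so up to a scalar multiple of [b]. The matrix of these
    scalars has rank [size N], because at a point [x] lying on all the new
    hyperplanes and on none of the old ones the derivations of [D(A(T))] span
    the whole tangent space. After elimination, multiplying [size N] elements of
    the basis by the corresponding new forms gives a basis for [A(T ++ N)].

    Three facts about roots make this applicable.

    - Distinct roots of the same height have a nonpositive inner product, as
      their difference is not a root, and so they are linearly independent
      ([obtuse_free], [level_free]).

    - No positive root of height at most [h] lies in the span of [N]
      ([level_lowest]), so the point [x] exists. The roots of the span whose
      height is a multiple of [h + 1] form a subsystem with simple roots [N],
      and evaluating half of the sum of its positive coroots shows that every
      root of the span has a height in [(h + 1) / 2 * Z]. If there were roots of
      height [(h + 1) / 2], let [D] be the set of them. Together with the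
      elements of [N] that are not sums of two elements of [D] they are
      linearly independent, so [D] has at most as many elements as there are
      sums [d + d'] in [N]. Thus the graph with vertices [D] and with these sums
      as edges has a cycle, although the vectors of [D] are independent and
      obtuse; this is impossible, as for Dynkin diagrams.

    - The degree of [b] is at least [h] ([value_bound_root]). The polynomial [b]
      has a linear factor for each element of [T], except for one in each plane
      through [a] that meets [T]. On the other hand the height of [a] is half of
      the sum of the Cartan integers [cartan a c] over the positive roots [c].
      The term of [a] itself contributes [1] to the height, and the other terms
      are grouped by the planes through [a]; the contribution of a plane is at
      most the number of factors of [b] coming from it ([height_low]). *)

Set Implicit Arguments.
Unset Strict Implicit.
Unset Printing Implicit Defensive.

Import Order.TTheory GRing.Theory Num.Theory.
Local Open Scope ring_scope.

(** * The inner product *)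

Section InnerProduct.
Variables (R : realType) (l : nat).
Implicit Types (u v w a : 'rV[R]_l) (c : R) (s : seq 'rV[R]_l).

Lemma dotC u v : dot u v = dot v u.
Proof. by apply: eq_bigr => i _; rewrite mulrC. Qed.

Fact dot_is_linear u : linear_for *%R (dot u).
Proof.
move=> c v w; rewrite /dot mulr_sumr -big_split /=; apply: eq_bigr => i _.
by rewrite !mxE mulrDr mulrCA.
Qed.

HB.instance Definition _ u := GRing.isLinear.Build R 'rV[R]_l R *%R (dot u)
  (dot_is_linear u).

Lemma dotDl u v w : dot (u + v) w = dot u w + dot v w.
Proof. by rewrite !(dotC _ w) linearD. Qed.

Lemma dotBl u v w : dot (u - v) w = dot u w - dot v w.
Proof. by rewrite !(dotC _ w) linearB. Qed.

Lemma dotZl c u w : dot (c *: u) w = c * dot u w.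
Proof. by rewrite !(dotC _ w) linearZ. Qed.

Lemma dotNl u w : dot (- u) w = - dot u w.
Proof. by rewrite !(dotC _ w) linearN. Qed.

Lemma dot0l w : dot 0 w = 0.
Proof. by rewrite dotC linear0. Qed.

Lemma dot_suml (I : Type) (r : seq I) (P : pred I) (F : I -> 'rV[R]_l) w :
  dot (\sum_(i <- r | P i) F i) w = \sum_(i <- r | P i) dot (F i) w.
Proof. by rewrite dotC linear_sum; apply: eq_bigr => i _; rewrite dotC. Qed.

Lemma dot_ge0 v : 0 <= dot v v.
Proof. by apply: sumr_ge0 => i _; rewrite -expr2 sqr_ge0. Qed.

Lemma dot_eq0 v : (dot v v == 0) = (v == 0).
Proof.
apply/idP/eqP => [|->]; last by rewrite dot0l.
rewrite psumr_eq0 => [/allP v0|i _]; last by rewrite -expr2 sqr_ge0.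
apply/rowP => i; rewrite mxE; apply/eqP; rewrite -[_ == _]orbb -mulf_eq0.
exact: v0 (mem_index_enum i).
Qed.

Lemma dot_gt0 v : (0 < dot v v) = (v != 0).
Proof. by rewrite lt_def dot_ge0 dot_eq0 andbT. Qed.

Definition proj a v : 'rV[R]_l := v - (dot a v / dot a a) *: a.

Fact proj_is_linear a : linear (proj a).
Proof.
move=> c v w; rewrite /proj linearP scalerBr mulrDl scalerDl scalerA.
by rewrite mulrA opprD addrACA.
Qed.

HB.instance Definition _ a := GRing.isLinear.Build R 'rV[R]_l 'rV[R]_l *:%R
  (proj a) (proj_is_linear a).

Lemma proj_eq0P a v : proj a v = 0 -> exists c, v = c *: a.
Proof. by move/eqP; rewrite subr_eq0 => /eqP ->; eexists. Qed.

Lemma proj_self a : a != 0 -> proj a a = 0.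
Proof. by rewrite -dot_eq0 => a0; rewrite /proj divff // scale1r subrr. Qed.

Lemma dot_proj a v : a != 0 -> dot a (proj a v) = 0.
Proof.
by rewrite -dot_eq0 => a0; rewrite linearB linearZ /= divfK // subrr.
Qed.

Lemma dot_span0 s w u : {in s, forall a, dot a u = 0} -> w \in <<s>>%VS ->
  dot w u = 0.
Proof.
move=> su; rewrite -[s]/(tval (in_tuple s)) => /coord_span ->.
rewrite dot_suml big1 // => i _.
by rewrite dotZl su ?mulr0 // mem_nth ?size_tuple.
Qed.

Lemma orthogonal_residual s v :
  exists2 u, v - u \in <<s>>%VS & {in s, forall a, dot a u = 0}.
Proof.
elim: s v => [|a s IHs] v; first by exists v; rewrite ?subrr ?mem0v.
have [a' sa' oa'] := IHs a; have [u su ou] := IHs v.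
have sub_s : {subset <<s>>%VS <= <<a :: s>>%VS}.
  by apply/subvP; rewrite span_cons addvSr.
have a_span : a \in <<a :: s>>%VS by rewrite memv_span ?mem_head.
have a'_span : a' \in <<a :: s>>%VS.
  by rewrite -[a'](subKr a) rpredB // sub_s.
have a_def : a = a' + (a - a') by rewrite addrC subrK.
have [a'0|a'0] := eqVneq a' 0.
  exists u; first exact: sub_s.
  move=> b; rewrite inE => /predU1P[->|/ou //].
  by apply: (dot_span0 ou); rewrite -[a]subr0 -a'0.
exists (proj a' u); last first.
  move=> b; rewrite inE => /predU1P[->|sb]; last first.
    by rewrite /proj linearB linearZ /= ou // (oa' b) // mulr0 subrr.
  rewrite a_def dotDl dot_proj // add0r /proj linearB linearZ /=.
  by rewrite (dot_span0 ou sa') (dot_span0 oa' sa') mulr0 subrr.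
by rewrite /proj opprB addrCA rpredD ?rpredZ // sub_s.
Qed.

(** Linear functionals separate a subspace from a vector outside it; the inner
    product makes the functional a vector. *)
Lemma separating_vector s v : v \notin <<s>>%VS ->
  exists2 u, {in s, forall a, dot a u = 0} & dot v u != 0.
Proof.
have [u suv ou] := orthogonal_residual s v; move=> nsv; exists u => //.
have -> : v = u + (v - u) by rewrite addrC subrK.
rewrite dotDl (dot_span0 ou suv) addr0 dot_eq0.
by apply: contraNneq nsv => u0; rewrite -[v]subr0 -u0.
Qed.

Lemma exists_notin (s : seq R) : exists c, c \notin s.
Proof.
exists (1 + \sum_(x <- s) `|x|); apply/negP => cs.
have : `|1 + \sum_(x <- s) `|x| | <= \sum_(x <- s) `|x|.
  by rewrite [leRHS](big_rem _ cs) /= lerDl sumr_ge0.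
by rewrite ger0_norm ?addr_ge0 ?sumr_ge0 // gerDr ler10.
Qed.

(** A subspace is not covered by finitely many hyperplanes that do not
    contain it; the subspace is the orthogonal of [N]. *)
Lemma point_off_hyperplanes (N T : seq 'rV[R]_l) :
    {in T, forall g, g \notin <<N>>%VS} ->
  exists x, {in N, forall a, dot a x = 0} /\ {in T, forall g, dot g x != 0}.
Proof.
elim: T => [|g T IHT] NT.
  by exists 0; split=> // a _; rewrite linear0.
have [|x [Nx Tx]] := IHT; first by move=> b Tb; apply: NT; rewrite inE Tb orbT.
have [gx|gx] := eqVneq (dot g x) 0; last first.
  by exists x; split=> // b; rewrite inE => /predU1P[-> | /Tx].
have [v Nv gv] := separating_vector (NT _ (mem_head _ _)).
have [c] := exists_notin (0 :: [seq - dot b x / dot b v | b <- T]).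
rewrite inE negb_or => /andP[c0 cT].
exists (x + c *: v); split=> b.
  by move=> Nb; rewrite linearD linearZ /= Nx // Nv // mulr0 addr0.
rewrite inE linearD linearZ /= => /predU1P[->|Tb].
  by rewrite gx add0r mulf_neq0.
have [bv|bv] := eqVneq (dot b v) 0; first by rewrite bv mulr0 addr0 Tx.
apply: contraNneq cT => bxv; apply/mapP; exists b => //.
by apply: (mulIf bv); rewrite divfK //; apply/eqP; rewrite -addr_eq0 addrC bxv.
Qed.

End InnerProduct.

(** * Linear forms as primes *)

Section LinearForms.
Variables (R : realType) (l : nat).
Notation V := 'rV[R]_l.
Notation S := {mpoly R[l]}.
Implicit Types (u v w a b : V) (c : R) (s t : seq V) (p q f : S).

Definition lform v : S := \sum_i v 0 i *: 'X_i.

Fact lform_is_linear : linear lform.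
Proof.
move=> c v w; rewrite /lform scaler_sumr -big_split /=; apply: eq_bigr => i _.
by rewrite !mxE scalerDl scalerA.
Qed.

HB.instance Definition _ := GRing.isLinear.Build R V S *:%R lform
  lform_is_linear.

Lemma meval_lform v (x : V) : (lform v).@[fun i => x 0 i] = dot v x.
Proof.
rewrite /lform raddf_sum /=; apply: eq_bigr => i _.
by rewrite mevalZ mevalXU.
Qed.

Lemma lform_eq0 v : lform v = 0 -> v = 0.
Proof.
by move=> v0; apply/eqP; rewrite -dot_eq0 -meval_lform v0 meval0.
Qed.

Lemma lform_delta i : lform (delta_mx 0 i) = 'X_i.
Proof.
rewrite /lform (bigD1 i) //= mxE !eqxx scale1r big1 ?addr0 // => j ji.
by rewrite mxE (negPf ji) andbF scale0r.
Qed.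

Lemma lform_homog v : lform v \is 1.-homog.
Proof.
by apply: rpred_sum => i _; apply: rpredZ; rewrite dhomogX /= mdeg1.
Qed.

Lemma homog1_lform p : p \is 1.-homog -> exists v, p = lform v.
Proof.
move=> p1; exists (\row_i p@_U_(i)); apply/mpolyP => m.
rewrite /lform raddf_sum /=.
have [/existsP[i /eqP ->]|] := boolP [exists i, m == U_(i)%MM].
  rewrite (bigD1 i) //= mcoeffZ mcoeffX eqxx mulr1 mxE big1 ?addr0 // => j ji.
  rewrite mcoeffZ mcoeffX; case: eqP => [/mnmP/(_ j)|]; last by rewrite mulr0.
  by rewrite !mnm1E eqxx eq_sym (negPf ji).
rewrite -mdeg_eq1 => m1; rewrite (dhomog_nemf_coeff p1 m1) big1 // => i _.
rewrite mcoeffZ mcoeffX; case: eqP => [im|]; last by rewrite mulr0.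
by rewrite -im mdeg1 in m1.
Qed.

Definition mdvd p q := exists r, q = p * r.

(** Substitution of [lform (proj a e_i)] for the [i]-th variable: the
    restriction of polynomials to the hyperplane orthogonal to [a], that is,
    the quotient map by [lform a] realized inside the polynomial ring itself. *)
Definition red a : S -> S :=
  comp_mpoly [tuple lform (proj a (delta_mx 0 i)) | i < l].

HB.instance Definition _ a := GRing.RMorphism.on (red a).

Lemma redZ a c p : red a (c *: p) = c *: red a p.
Proof. exact: comp_mpolyZ. Qed.

Lemma redX a i : red a 'X_i = lform (proj a (delta_mx 0 i)).
Proof. by rewrite /red comp_mpolyXU -tnth_nth tnth_mktuple. Qed.

Lemma red_lform a v : red a (lform v) = lform (proj a v).
Proof.
rewrite {1}/lform raddf_sum [v in RHS]row_sum_delta !linear_sum /=.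
by apply: eq_bigr => i _; rewrite redZ redX !linearZ.
Qed.

Lemma mdvdD p q q' : mdvd p q -> mdvd p q' -> mdvd p (q + q').
Proof. by move=> [r ->] [r' ->]; exists (r + r'); rewrite mulrDr. Qed.

Lemma mdvdMl p q r : mdvd p q -> mdvd p (r * q).
Proof. by move=> [q' ->]; exists (r * q'); rewrite mulrCA. Qed.

Lemma mdvdMr p q r : mdvd p q -> mdvd p (q * r).
Proof. by move=> [q' ->]; exists (q' * r); rewrite mulrA. Qed.

Lemma mdvdN p q : mdvd p q -> mdvd p (- q).
Proof. by move=> [q' ->]; exists (- q'); rewrite mulrN. Qed.

Lemma mdvd0 p : mdvd p 0.
Proof. by exists 0; rewrite mulr0. Qed.

Lemma mdvd_sum p (I : Type) (r : seq I) (P : pred I) (F : I -> S) :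
  (forall i, P i -> mdvd p (F i)) -> mdvd p (\sum_(i <- r | P i) F i).
Proof.
by move=> pF; elim/big_rec: _ => [|i q Pi]; [exact: mdvd0|apply/mdvdD/pF].
Qed.

Lemma mdvdZ p q c : mdvd p q -> mdvd p (c *: q).
Proof. by rewrite -mul_mpolyC; apply: mdvdMl. Qed.

(** By multiplicativity of [red a], only the variables have to be checked. *)
Lemma red_congr a p : mdvd (lform a) (p - red a p).
Proof.
have mul q q' : mdvd (lform a) (q - red a q) ->
    mdvd (lform a) (q' - red a q') -> mdvd (lform a) (q * q' - red a (q * q')).
  rewrite rmorphM /= => aq aq'.
  have -> : q * q' - red a q * red a q'
      = (q - red a q) * q' + red a q * (q' - red a q') by ring.
  by apply: mdvdD; [apply: mdvdMr | apply: mdvdMl].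
elim/mpolyind: p => [|c m p _ _ ap].
  by rewrite rmorph0 subrr; exact: mdvd0.
rewrite rmorphD /= opprD addrACA; apply: mdvdD => //.
rewrite redZ -scalerBr; apply: mdvdZ; rewrite mpolyXE_id.
elim/big_rec: _ => [|i q _]; first by rewrite rmorph1 subrr; exact: mdvd0.
move=> aq; apply: (mul) => //; elim: (m i) => [|k IHk].
  by rewrite expr0 rmorph1 subrr; exact: mdvd0.
rewrite exprS; apply: mul => //; rewrite redX -lform_delta -linearB /proj subKr.
exists (dot a (delta_mx 0 i) / dot a a)%:MP.
by rewrite [RHS]mulrC mul_mpolyC linearZ.
Qed.

Lemma mdvd_red a p : a != 0 -> mdvd (lform a) p <-> red a p = 0.
Proof.
move=> a0; split=> [[q ->]|p0].
  by rewrite rmorphM /= red_lform proj_self // linear0 mul0r.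
by have := red_congr a p; rewrite p0 subr0.
Qed.

(** The quotient by [lform a] embeds, via [red a], into a polynomial ring, and
    that is an integral domain. *)
Lemma lform_prime a p q : a != 0 ->
  mdvd (lform a) (p * q) -> mdvd (lform a) p \/ mdvd (lform a) q.
Proof.
move=> a0 /(mdvd_red _ a0)/eqP; rewrite rmorphM mulf_eq0 => /orP[]/eqP ap.
  by left; apply/mdvd_red.
by right; apply/mdvd_red.
Qed.

Lemma mdvd_lform a b : a != 0 -> mdvd (lform a) (lform b) -> proj a b = 0.
Proof. by move=> a0 /(mdvd_red _ a0); rewrite red_lform => /lform_eq0. Qed.

Definition prod_lform s : S := \prod_(a <- s) lform a.

Lemma lform_neq0 a : a != 0 -> lform a != 0.
Proof. by apply: contraNneq => /lform_eq0 ->. Qed.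

Lemma prod_lform_homog s : prod_lform s \is (size s).-homog.
Proof.
rewrite /prod_lform; elim: s => [|a s IHs]; first by rewrite big_nil dhomog1.
rewrite big_cons; apply: (dhomogM (d := 1)) => //; apply: lform_homog.
Qed.

Lemma mdvd_prod_lform a s : a != 0 -> mdvd (lform a) (prod_lform s) ->
  exists2 b, b \in s & proj a b = 0.
Proof.
move=> a0; rewrite /prod_lform; elim: s => [|b s IHs].
  rewrite big_nil => /(mdvd_red _ a0)/eqP; rewrite rmorph1 oner_eq0 //.
rewrite big_cons => /(lform_prime a0)[/(mdvd_lform a0) ab|/IHs[b' sb' ab']].
  by exists b; rewrite ?mem_head.
by exists b'; rewrite // inE sb' orbT.
Qed.

Lemma mdvd_cancel_prod s p f : {in s, forall a, a != 0 /\ ~ mdvd (lform a) p} ->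
  mdvd (prod_lform s) (p * f) -> mdvd (prod_lform s) f.
Proof.
rewrite /prod_lform; elim: s f => [|a s IHs] f sp.
  by rewrite big_nil => _; exists f; rewrite mul1r.
rewrite big_cons => -[r pf]; have [a0 ap] := sp a (mem_head _ _).
have [/ap //|[f' f_def]] : mdvd (lform a) p \/ mdvd (lform a) f.
  by apply: lform_prime => //; rewrite pf -mulrA; eexists.
have [] := IHs f'; first by move=> b sb; apply: sp; rewrite inE sb orbT.
  exists r; apply: (mulfI (lform_neq0 a0)).
  by rewrite mulrCA -f_def pf mulrA.
by move=> r' f'_def; exists r'; rewrite f_def f'_def mulrA.
Qed.

Lemma mdvd_prod_coprime p s f : mdvd p f -> mdvd (prod_lform s) f ->
  {in s, forall a, a != 0 /\ ~ mdvd (lform a) p} -> mdvd (p * prod_lform s) f.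
Proof.
move=> [r ->] sf ps; have [r' ->] := mdvd_cancel_prod ps sf.
by exists r'; rewrite mulrA.
Qed.

Lemma mdvd_prod_pairwise s f : uniq s -> 0 \notin s ->
    {in s &, forall a b, a != b -> proj a b != 0} ->
    {in s, forall a, mdvd (lform a) f} ->
  mdvd (prod_lform s) f.
Proof.
rewrite /prod_lform; elim: s => [|a s IHs] /=.
  by rewrite big_nil => _ _ _ _; exists f; rewrite mul1r.
rewrite inE negb_or big_cons => /andP[sa us] /andP[a0 s0] sP sf.
have s_in b : b \in s -> b \in a :: s by rewrite inE => ->; rewrite orbT.
apply: mdvd_prod_coprime.
- by apply: sf; rewrite mem_head.
- apply: IHs => // [b b' sb sb'|b sb]; last by apply/sf/s_in.
  by apply: sP; apply: s_in.
- move=> b sb; have b0: b != 0 by apply: contraNneq s0 => <-.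
  split=> // /(mdvd_lform b0)/eqP; apply/negP/sP; rewrite ?mem_head ?s_in //.
  by apply: contraNneq sa => <-.
Qed.

Lemma red_homog a d p : p \is d.-homog -> red a p \is d.-homog.
Proof.
move=> pd; rewrite [p]mpolyE raddf_sum /= big_seq; apply: rpred_sum => m mp.
rewrite redZ; apply: rpredZ; rewrite /red comp_mpolyX.
have <- := dhomog_mf pd mp; rewrite /= mdegE.
elim/big_rec2: _ => [|i e q _ qe]; first exact: dhomog1.
apply: dhomogM => //; rewrite tnth_mktuple.
by have := dhomogMn (m i) (lform_homog (proj a (delta_mx 0 i))); rewrite mul1n.
Qed.

End LinearForms.

(** * Derivations and logarithmic derivations *)

Section Derivations.
Variables (R : realType) (l : nat).
Notation V := 'rV[R]_l.
Notation S := {mpoly R[l]}.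
Implicit Types (u v w a b x : V) (c : R) (T N : seq V) (p q f : S).
Implicit Types (theta eta : S -> S).

Lemma derD theta p q : is_derivation theta ->
  theta (p + q) = theta p + theta q.
Proof. by move=> [lin _]; have := lin 1 p q; rewrite !scale1r. Qed.

Lemma der0 theta : is_derivation theta -> theta 0 = 0.
Proof. by move=> d; apply: (addrI (theta 0)); rewrite -derD // !addr0. Qed.

Lemma derZ theta c p : is_derivation theta -> theta (c *: p) = c *: theta p.
Proof. by move=> d; rewrite -[c *: p]addr0 d.1 der0 // addr0. Qed.

Lemma der1 theta : is_derivation theta -> theta 1 = 0.
Proof.
move=> d; apply: (addrI (theta 1)); rewrite addr0.
by have := d.2 1 1; rewrite !mulr1 mul1r => <-.
Qed.

Lemma der_lform theta a : is_derivation theta ->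
  theta (lform a) = \sum_i a 0 i *: theta 'X_i.
Proof.
move=> d; rewrite /lform; elim/big_rec2: _ => [|i p q _ <-]; first exact: der0.
by rewrite derD // derZ.
Qed.

(** Both sides are derivations that agree on the variables. *)
Lemma derivation_expand theta p : is_derivation theta ->
  theta p = \sum_i theta 'X_i * p^`M(i).
Proof.
move=> d; pose E p := theta p = \sum_i theta 'X_i * p^`M(i).
have EM p' q : E p' -> E q -> E (p' * q).
  rewrite /E d.2 => -> ->; rewrite mulr_suml mulr_sumr -big_split /=.
  by apply: eq_bigr => i _; rewrite mderivM; ring.
have E1 : E 1.
  by rewrite /E der1 // big1 // => i _; rewrite -mpolyC1 mderivC mulr0.
have EX i : E 'X_i.
  rewrite /E (bigD1 i) //= mderivX mnm1E eqxx scale1r.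
  rewrite (_ : (U_(i) - U_(i))%MM = 0%MM); last first.
    by apply/mnmP => j; rewrite mnmBE subnn mnm0E.
  rewrite mpolyX0 mulr1 big1 ?addr0 // => j ji.
  by rewrite mderivX mnm1E eq_sym (negPf ji) scale0r mulr0.
suff: E p by [].
elim/mpolyind: p => [|c m p _ _ IHp].
  by rewrite /E der0 // big1 // => i _; rewrite mderiv0 mulr0.
rewrite /E derD // derZ // IHp.
have -> : theta 'X_[m] = \sum_i theta 'X_i * 'X_[m]^`M(i).
  rewrite -/(E _) mpolyXE_id; elim/big_rec: _ => // i q _; apply: (EM).
  by elim: (m i) => [|k IHk]; rewrite ?expr0 // exprS; apply: EM.
rewrite scaler_sumr -big_split /=; apply: eq_bigr => i _.
by rewrite mderivD mderivZ mulrDr scalerAr.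
Qed.

Lemma mderiv_derivation i : is_derivation (@mderiv l R i).
Proof.
split=> [c p q|p q]; first by rewrite mderivD mderivZ.
exact: mderivM.
Qed.

Lemma mderiv_lform i a : (lform a)^`M(i) = (a 0 i)%:MP.
Proof.
rewrite (der_lform _ (mderiv_derivation i)) (bigD1 i) //=.
rewrite mderivX mnm1E eqxx scale1r.
rewrite (_ : (U_(i) - U_(i))%MM = 0%MM); last first.
  by apply/mnmP => j; rewrite mnmBE subnn mnm0E.
rewrite mpolyX0 big1 ?addr0 => [|j ji]; first by rewrite alg_mpolyC.
by rewrite mderivX mnm1E (negPf ji) scale0r scaler0.
Qed.

(** The defining forms of the hyperplane orthogonal to [a] are the nonzero
    multiples of [lform a], so logarithmic derivations can be tested on the
    forms [lform a] only. *)
Lemma in_D_lform T theta : 0 \notin T ->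
  in_D (root_arrangement T) theta <->
  is_derivation theta /\ {in T, forall a, mdvd (lform a) (theta (lform a))}.
Proof.
move=> T0; split=> -[d dT]; split=> //.
  move=> a Ta; apply: (dT (hyperplane_of a)); first exact: map_f.
  by split=> [|v]; [exact: lform_homog | rewrite mem_hyperplane_of meval_lform].
move=> _ p /mapP[a Ta ->] [/homog1_lform[b ->] ab].
have a0 : a != 0 by apply: contraNneq T0 => <-.
have [c ->] : exists c, b = c *: a.
  apply: proj_eq0P; apply/eqP; rewrite -dot_eq0.
  have := ab (proj a b); rewrite mem_hyperplane_of meval_lform.
  rewrite dot_proj // eqxx => /esym/eqP bp.
  by rewrite [X in dot X _]/proj dotBl dotZl dot_proj // bp mulr0 subrr.
have [q aq] := dT a Ta; exists q.
by rewrite linearZ /= derZ // aq scalerAl.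
Qed.

Lemma in_D_sub (A : seq {vspace V}) theta eta c :
  in_D A theta -> in_D A eta -> in_D A (fun p => theta p - c *: eta p).
Proof.
move=> [d dA] [d' dA']; split=> [|H p HA Hp].
  split=> [k p q|p q].
    by rewrite d.1 d'.1 scalerBr scalerDr !scalerA mulrC opprD addrACA.
  by rewrite d.2 d'.2 -!mul_mpolyC; ring.
have [q ->] := dA H p HA Hp; have [q' ->] := dA' H p HA Hp.
by exists (q - c *: q'); rewrite mulrBr scalerAr.
Qed.

Lemma in_D_mul (A : seq {vspace V}) theta f :
  in_D A theta -> in_D A (fun p => f * theta p).
Proof.
move=> [d dA]; split=> [|H p HA Hp].
  split=> [k p q|p q]; first by rewrite d.1 mulrDr scalerAr.
  by rewrite d.2; ring.
by have [q ->] := dA H p HA Hp; exists (f * q); rewrite mulrCA.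
Qed.

Lemma homogeneous_derP d theta :
  (forall a, theta (lform a) \is d.-homog) <-> homogeneous_der d theta.
Proof.
split=> th => [p /homog1_lform[a ->]|a]; first exact: th.
exact: th (lform_homog a).
Qed.

Lemma basis_D_nil : is_basis_D (root_arrangement [::]) (@mderiv l R).
Proof.
split=> [i|eta [d _]|c c0 i].
- by apply/in_D_lform => //; split; [exact: mderiv_derivation|].
- by exists (fun i => eta 'X_i) => p; apply: derivation_expand.
- have := c0 'X_i; rewrite (bigD1 i) //= -lform_delta mderiv_lform mxE !eqxx.
  rewrite big1 ?addr0 ?mulr1 // => j ji.
  by rewrite mderiv_lform mxE (negPf ji) andbF mulr0.
Qed.

(** Away from the arrangement the logarithmic vector fields span the tangent
    space, since the product of the defining forms times any constant vector
    field is logarithmic. *)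
Lemma basis_spans_at T (theta : 'I_l -> S -> S) x v : 0 \notin T ->
    is_basis_D (root_arrangement T) theta ->
    {in T, forall g, dot g x != 0} ->
  exists s : 'I_l -> R, forall a,
    dot a v = \sum_i s i * (theta i (lform a)).@[fun i => x 0 i].
Proof.
move=> T0 [_ spanT _] Tx.
pose Q := prod_lform T; pose eta p : S := Q * \sum_i v 0 i *: p^`M(i).
have Qx : Q.@[fun i => x 0 i] != 0.
  rewrite /Q /prod_lform rmorph_prod /= prodf_seq_neq0; apply/allP => g Tg.
  by rewrite /= meval_lform Tx.
have eta_der : is_derivation eta.
  split=> [c p q|p q].
    rewrite /eta scalerAr -mulrDr scaler_sumr -big_split /=; congr (_ * _).
    apply: eq_bigr => i _.
    by rewrite mderivD mderivZ scalerDr !scalerA mulrC.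
  have -> : eta (p * q) = Q * ((\sum_i v 0 i *: p^`M(i)) * q
      + p * \sum_i v 0 i *: q^`M(i)).
    rewrite mulr_suml mulr_sumr -big_split /=; congr (_ * _).
    apply: eq_bigr => i _.
    by rewrite mderivM scalerDr scalerAl scalerAr.
  by rewrite /eta; ring.
have /spanT[c c_eta] : in_D (root_arrangement T) eta.
  apply/in_D_lform => //; split=> // g Tg.
  by rewrite /eta /Q /prod_lform (big_rem g Tg) /= -!mulrA; eexists.
exists (fun i => (c i).@[fun i => x 0 i] / Q.@[fun i => x 0 i]) => a.
apply: (mulfI Qx).
have := congr1 (meval (fun i => x 0 i)) (c_eta (lform a)).
rewrite /eta mevalM [X in _ * X]raddf_sum /=.
under eq_bigr do rewrite mevalZ mderiv_lform mevalC mulrC.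
rewrite -/(dot a v) => ->; rewrite raddf_sum mulr_sumr /=.
by apply: eq_bigr => i _; rewrite mevalM mulrA [Q.@[_] * _]mulrC divfK.
Qed.

Lemma basis_D_elim (A : seq {vspace V}) (theta : 'I_l -> S -> S) k (i0 : 'I_l) :
    k i0 = 0 -> is_basis_D A theta ->
  is_basis_D A (fun i p => theta i p - k i *: theta i0 p).
Proof.
move=> k0 [thetaA spanA freeA].
have sumE (c : 'I_l -> S) p : \sum_i c i * (theta i p - k i *: theta i0 p)
    = \sum_i (c i - (i == i0)%:R * \sum_j k j *: c j) * theta i p.
  under [RHS]eq_bigr do rewrite mulrBl.
  under [LHS]eq_bigr do rewrite mulrBr.
  rewrite !sumrB; congr (_ - _).
  rewrite [RHS](bigD1 i0) //= eqxx mul1r [X in _ + X]big1 ?addr0.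
    by rewrite mulr_suml; apply: eq_bigr => i _; rewrite -scalerAr scalerAl.
  by move=> i /negPf ->; rewrite !mul0r.
split=> [i|eta /spanA[c c_eta]|c c0 i].
- exact: in_D_sub.
- exists (fun i => c i + (i == i0)%:R * \sum_j k j *: c j) => p.
  rewrite sumE c_eta; apply: eq_bigr => i _; congr (_ * _).
  rewrite -addrA -mulrBr -sumrB big1 ?mulr0 ?addr0 // => j _.
  have [->|] := eqVneq j i0; first by rewrite k0 !scale0r subrr.
  by rewrite mul0r addr0 subrr.
- have {}c0 j : c j - (j == i0)%:R * \sum_j k j *: c j = 0.
    apply: (freeA (fun j => c j - (j == i0)%:R * \sum_j k j *: c j)) => p.
    by rewrite -sumE.
  have cN j : j != i0 -> c j = 0.
    by move=> ji; have := c0 j; rewrite (negPf ji) mul0r subr0.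
  have [->|/cN //] := eqVneq i i0.
  have := c0 i0; rewrite eqxx mul1r big1 ?subr0 // => j _.
  by have [->|/cN ->] := eqVneq j i0; rewrite ?k0 ?scale0r ?scaler0.
Qed.

End Derivations.

(** * Adding several hyperplanes to a free arrangement *)

Section MultipleAddition.
Variables (R : realType) (l : nat).
Notation V := 'rV[R]_l.
Notation S := {mpoly R[l]}.
Implicit Types (u v w a b x : V) (c : R) (T N : seq V) (p q f : S).
Implicit Types (pv : seq ('I_l * V)).

Definition ev x : S -> R := meval (fun i => x 0 i).

Lemma ev_mdvd a x p : dot a x = 0 -> mdvd (lform a) p -> ev x p = 0.
Proof. by move=> ax [q ->]; rewrite /ev mevalM meval_lform ax mul0r. Qed.

Lemma ev_red a x p : dot a x = 0 -> ev x (red a p) = ev x p.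
Proof.
move=> ax; apply/eqP; rewrite eq_sym -subr_eq0 -mevalB.
by apply/eqP/(ev_mdvd ax)/red_congr.
Qed.

(** Degrees leave room only for a scalar cofactor, which moreover vanishes
    unless all the degrees agree. *)
Lemma homog_multiple d e h p (b : S) f : p \is e.-homog -> b \is d.-homog ->
    p = b * f -> (e <= h)%N -> (h <= d)%N ->
  exists c, p = c *: b /\ (c != 0 -> e = h).
Proof.
move=> pe bd pbf eh hd; have [p0|p0] := eqVneq p 0.
  by exists 0; rewrite scale0r eqxx.
have [b0 f0] : b != 0 /\ f != 0 by move: p0; rewrite pbf mulf_eq0 => /norP.
have sz q k : q != 0 -> q \is k.-homog -> msize q = k.+1.
  move=> q0 qk; have /(dhomog_uniq q0 qk) : q \is (msize q).-1.-homog.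
    exact: dhomog_msize qk.
  by move=> ->; rewrite prednK // lt0n mmeasure_poly_eq0.
have := msizeM b0 f0; rewrite -pbf (sz _ _ p0 pe) (sz _ _ b0 bd).
have : (0 < msize f)%N by rewrite lt0n mmeasure_poly_eq0.
case f1 : (msize f) => [//|n] _; rewrite addSn /= addnS => -[ed].
have n0 : n = 0%N.
  by apply/eqP; rewrite -leqn0 -(leq_add2l d) -ed addn0 (leq_trans eh).
have /msize_poly1P[c _ fc] : msize f == 1%N by rewrite f1 n0.
exists c; split; first by rewrite pbf fc mulrC mul_mpolyC.
by move=> _; apply/eqP; rewrite eqn_leq eh ed n0 addn0.
Qed.

(** By degree, a homogeneous basis element of degree at most [h] then has only
    one scalar as an obstruction to being logarithmic along the hyperplane of
    [a], and none in degree less than [h]. *)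
Definition value_bound T h a := exists (b : S) d,
  [/\ b \is d.-homog, (h <= d)%N
    & forall theta, in_D (root_arrangement T) theta ->
        exists f, red a (theta (lform a)) = b * f].

(** Each new form [a] gets an index [i], its pivot, such that [theta i] is the
    only basis element that is not logarithmic along the hyperplane of [a]. The
    nonzero value at [x] witnesses this failure; it lets the elimination find a
    new pivot for the next form. *)
Definition pivots (theta : 'I_l -> S -> S) (e : 'I_l -> nat) h x pv :=
  uniq (map fst pv) /\ forall i a, (i, a) \in pv ->
    [/\ e i = h, ev x (theta i (lform a)) != 0
      & forall j, j != i -> mdvd (lform a) (theta j (lform a))].

(** Gaussian elimination on the matrix of values modulo the new forms. It has
    full rank because at [x] the derivations span the tangent space, where the
    new forms are independent. *)
Lemma adapted_basis T N (e : 'I_l -> nat) h x (theta0 : 'I_l -> S -> S) :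
    0 \notin T -> free N ->
    {in N, forall a, dot a x = 0} -> {in T, forall g, dot g x != 0} ->
    {in N, forall a, value_bound T h a} ->
    (forall i, (e i <= h)%N) ->
    is_basis_D (root_arrangement T) theta0 ->
    (forall i, homogeneous_der (e i) (theta0 i)) ->
  exists theta pv, [/\ is_basis_D (root_arrangement T) theta,
    forall i, homogeneous_der (e i) (theta i),
    pivots theta e h x pv & map snd pv = N].
Proof.
move=> T0 + + Tx + eh basis0 hom0.
elim: N => [|a N IHN] freeN Nx Nb; first by exists theta0, [::].
have N_in b : b \in N -> b \in a :: N by rewrite inE => ->; rewrite orbT.
move: freeN; rewrite free_cons => /andP[aN freeN].
have [||theta [pv [basis hom [upv pvP] pvN]]] := IHN freeN.
- by move=> b Nb'; apply/Nx/N_in.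
- by move=> b Nb'; apply/Nb/N_in.
have ax : dot a x = 0 := Nx a (mem_head _ _).
have a0 : a != 0 by apply: contraNneq aN => ->; rewrite mem0v.
have [b [d [bd hd bP]]] := Nb a (mem_head _ _).
have /fin_all_exists[c cP] i : exists c,
    red a (theta i (lform a)) = c *: b /\ (c != 0 -> e i = h).
  have [thetaT _ _] := basis; have [f fP] := bP _ (thetaT i).
  apply: homog_multiple bd fP (eh i) hd.
  by apply/red_homog/hom/lform_homog.
(* The tangent vector [v] is orthogonal to the forms treated before, so its
   coefficients at their pivots vanish; as [v] is not orthogonal to [a], some
   other index carries a nonzero value on [a], and it is the pivot of [a]. *)
have [v Nv av] := separating_vector aN.
have [s sP] := basis_spans_at v T0 basis Tx.
have [i0 /andP[s0 evi0]] :
    exists i, (s i != 0) && (ev x (theta i (lform a)) != 0).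
  apply/existsP; apply: contraNT av; rewrite negb_exists => /forallP s0.
  rewrite sP big1 // => i _; apply/eqP; rewrite mulf_eq0 -[_ || _]negbK negb_or.
  exact: s0.
have c0 : c i0 != 0.
  apply: contraNneq evi0 => c0.
  by rewrite -(ev_red _ ax) (cP i0).1 c0 scale0r /ev meval0.
have i0pv : i0 \notin map fst pv.
  apply: contraNN s0 => /mapP[[i a'] pva' /= ->].
  have Na' : a' \in N by rewrite -pvN; apply: (map_f snd pva').
  have [_ ev0 dvd] := pvP _ _ pva'.
  have := sP a'; rewrite Nv // (bigD1 i) //= big1 ?addr0 => [/esym/eqP|j ji].
    by rewrite mulf_eq0 (negPf ev0) orbF.
  by rewrite [X in _ * X](ev_mdvd (Nx a' (N_in a' Na')) (dvd j ji)) mulr0.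
pose k i := if i == i0 then 0 else c i / c i0.
have k0 : k i0 = 0 by rewrite /k eqxx.
exists (fun i p => theta i p - k i *: theta i0 p), ((i0, a) :: pv); split.
- exact: basis_D_elim.
- move=> i p p1; apply: rpredB; first exact: hom.
  have [ki|ki] := eqVneq (k i) 0; first by rewrite ki scale0r rpred0.
  rewrite (_ : e i = e i0); first by apply/rpredZ/hom.
  rewrite (cP i0).2 // (cP i).2 //; apply: contraNneq ki => ci.
  by rewrite /k ci mul0r if_same.
- split=> [|i a']; first by rewrite /= i0pv.
  rewrite inE => /predU1P[[-> ->]|pva'].
    split; first exact: (cP i0).2.
      by rewrite k0 scale0r subr0.
    move=> j ji; apply/mdvd_red => //.
    rewrite rmorphB /= redZ (cP j).1 (cP i0).1 scalerA /k (negPf ji) divfK //.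
    by rewrite subrr.
  have [ei ev0 dvd] := pvP _ _ pva'.
  have ii0 : i0 != i.
    by apply: contraNneq i0pv => ->; apply: (map_f fst pva').
  have Na' : a' \in N by rewrite -pvN; apply: (map_f snd pva').
  split=> // [|j ji].
    rewrite /ev mevalB mevalZ -/(ev x _) -/(ev x _).
    by rewrite (ev_mdvd (Nx a' (N_in a' Na')) (dvd _ ii0)) mulr0 subr0.
  by apply: mdvdD; [apply: dvd | apply/mdvdN/mdvdZ/dvd].
- by rewrite /= pvN.
Qed.

(** As pivots are distinct, the product has at most one factor. *)
Definition pivot_mult pv i : S := \prod_(ia <- pv | ia.1 == i) lform ia.2.

Lemma pivot_mult_notin pv i : i \notin map fst pv -> pivot_mult pv i = 1.
Proof.
rewrite /pivot_mult; elim: pv => [|[j a] pv IHpv]; first by rewrite big_nil.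
by rewrite /= inE negb_or big_cons /= eq_sym => /andP[/negPf -> /IHpv].
Qed.

Lemma pivot_mult_in pv i a : uniq (map fst pv) -> (i, a) \in pv ->
  pivot_mult pv i = lform a.
Proof.
elim: pv => [//|[j b] pv IHpv] /= /andP[jpv upv].
rewrite inE /pivot_mult big_cons /= => /predU1P[[ij ->]|ipv].
  rewrite ij eqxx -[X in _ * X]/(pivot_mult pv j).
  by rewrite (pivot_mult_notin jpv) mulr1.
have -> : (j == i) = false.
  by apply: contraNF jpv => /eqP ->; apply: (map_f fst ipv).
exact: IHpv.
Qed.

(** The multiple addition theorem of Abe, Barakat, Cuntz, Hoge and Terao: [q]
    new hyperplanes turn [q] exponents [h] into [h + 1]. *)
Lemma multiple_addition T N T' (e : 'I_l -> nat) h x (theta0 : 'I_l -> S -> S) :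
    0 \notin T -> free N -> T' =i T ++ N ->
    {in N, forall a, dot a x = 0} -> {in T, forall g, dot g x != 0} ->
    {in N, forall a, value_bound T h a} ->
    (forall i, (e i <= h)%N) ->
    is_basis_D (root_arrangement T) theta0 ->
    (forall i, homogeneous_der (e i) (theta0 i)) ->
  exists theta (P : {set 'I_l}), [/\ #|P| = size N,
    {in P, forall i, e i = h},
    is_basis_D (root_arrangement T') theta
    & forall i, homogeneous_der (e i + (i \in P)) (theta i)].
Proof.
move=> T0 freeN T'E Nx Tx Nb eh basis0 hom0.
have [theta [pv [basis hom [upv pvP] pvN]]] :=
  adapted_basis T0 freeN Nx Tx Nb eh basis0 hom0.
have N0 : 0 \notin N by apply/negP => /(free_not0 freeN); rewrite eqxx.
have T'0 : 0 \notin T' by rewrite T'E mem_cat negb_or T0.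
have inN a : a \in N -> exists i, (i, a) \in pv.
  by rewrite -pvN => /mapP[[i b] pvb ->]; exists i.
have pv0 i a : (i, a) \in pv -> a != 0.
  move=> pva; apply: contraNneq N0 => <-; rewrite -pvN.
  exact: (map_f snd pva).
have mult_neq0 i : pivot_mult pv i != 0.
  have [/mapP[[j a] pva /= ->]|ipv] := boolP (i \in map fst pv).
    by rewrite (pivot_mult_in upv pva) lform_neq0 // (pv0 _ _ pva).
  by rewrite pivot_mult_notin ?oner_eq0.
exists (fun i p => pivot_mult pv i * theta i p), [set i in map fst pv].
have [thetaT spanT freeT] := basis.
split.
- by rewrite cardsE (card_uniqP upv) size_map -pvN size_map.
- by move=> i; rewrite inE => /mapP[[j a] pva ->]; have [] := pvP _ _ pva.
- split=> [i|eta etaT'|c c0 i].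
  + apply/in_D_lform => //.
    have [d dT] := (in_D_lform _ T0).1 (thetaT i); split.
      by have [] := in_D_mul (pivot_mult pv i) (thetaT i).
    move=> a; rewrite T'E mem_cat => /orP[/dT/mdvdMl //|/inN[j pva]].
    have [ij|ij] := eqVneq i j.
      rewrite ij (pivot_mult_in upv pva).
      exact/mdvdMr/(ex_intro _ 1)/esym/mulr1.
    by have [_ _ /(_ i ij)/mdvdMl] := pvP _ _ pva.
  + have [eta_der etadvd] := (in_D_lform _ T'0).1 etaT'.
    have /spanT[c c_eta] : in_D (root_arrangement T) eta.
      apply/in_D_lform => //; split=> // a Ta; apply: etadvd.
      by rewrite T'E mem_cat Ta.
    have /fin_all_exists[c' c'P] i : exists f, c i = f * pivot_mult pv i.
      have [/mapP[[j a] pva /= ->]|ipv] := boolP (i \in map fst pv); last first.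
        by exists (c i); rewrite pivot_mult_notin ?mulr1.
      rewrite (pivot_mult_in upv pva).
      have Na : a \in N by rewrite -pvN; apply: (map_f snd pva).
      have [_ ev0 dvd] := pvP _ _ pva.
      have : mdvd (lform a) (c j * theta j (lform a)).
        have -> : c j * theta j (lform a) = eta (lform a)
            - \sum_(k | k != j) c k * theta k (lform a).
          by rewrite c_eta (bigD1 j) //= addrK.
        apply: mdvdD; first by apply: etadvd; rewrite T'E mem_cat Na orbT.
        by apply/mdvdN/mdvd_sum => k kj; apply/mdvdMl/dvd.
      case/(lform_prime (pv0 _ _ pva)) => [[f ->]|/(ev_mdvd (Nx a Na))/eqP].
        by exists f; rewrite mulrC.
      by rewrite (negPf ev0).
    by exists c' => p; rewrite c_eta; apply: eq_bigr => i _; rewrite c'P mulrA.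
  + have /eqP : c i * pivot_mult pv i = 0.
      apply: (freeT (fun i => c i * pivot_mult pv i)) => p.
      by rewrite -[RHS](c0 p); apply: eq_bigr => j _; rewrite mulrA.
    by rewrite mulf_eq0 (negPf (mult_neq0 i)) orbF => /eqP.
- move=> i p p1; rewrite inE addnC.
  have [/mapP[[j a] pva /= ->]|ipv] := boolP (i \in map fst pv).
    rewrite (pivot_mult_in upv pva); apply: (@dhomogM _ _ _ 1).
      exact: lform_homog.
    exact: hom.
  by rewrite pivot_mult_notin // mul1r; apply: hom.
Qed.

End MultipleAddition.

(** * Values of logarithmic derivations on a new form *)

Section ValueBound.
Variables (R : realType) (l : nat).
Notation V := 'rV[R]_l.
Notation S := {mpoly R[l]}.
Implicit Types (u v w a b g : V) (c : R) (s T N : seq V) (p q f : S).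

(** The hyperplanes of [xi :: s] have the same trace on the hyperplane of [a].
    Each of their forms [g] is a combination of [xi] and [a], so that [lform g]
    divides the polynomial [w] below, and then so does their product. On the
    hyperplane of [a] only the second term of [w] survives, and it contains one
    spare factor, [lform xi]. *)
Lemma same_line_dvd a xi s theta : a != 0 ->
    uniq (xi :: s) -> 0 \notin xi :: s ->
    {in xi :: s &, forall g g', g != g' -> proj g g' != 0} ->
    {in xi :: s, forall g, proj a g != 0 /\ proj a g \in <[proj a xi]>%VS} ->
    is_derivation theta ->
    {in xi :: s, forall g, mdvd (lform g) (theta (lform g))} ->
  mdvd (prod_lform (map (proj a) s)) (red a (theta (lform a))).
Proof.
move=> a0 us s0 sP sxi d sd.
pose w := lform a * theta (lform xi) - lform xi * theta (lform a).
have [r wr] : mdvd (prod_lform (xi :: s)) w.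
  apply: mdvd_prod_pairwise => // g sg; have [ag /vlineP[c agc]] := sxi g sg.
  have [k gk] : exists k, g = c *: xi + k *: a.
    have [|k gk] := @proj_eq0P _ _ a (g - c *: xi).
      by rewrite linearB linearZ /= agc subrr.
    by exists k; rewrite -gk addrC subrK.
  have c0 : c != 0 by apply: contraNneq ag => c0; rewrite agc c0 scale0r.
  suff -> : w = c^-1 *: (lform a * theta (lform g) - lform g * theta (lform a)).
    by apply: mdvdZ; apply: mdvdD; [apply/mdvdMl/sd | apply/mdvdN; eexists].
  apply: (scalerI c0); rewrite scalerA divff // scale1r gk !linearD !linearZ /=.
  by rewrite (derD _ _ d) !(derZ _ _ d) /w -!mul_mpolyC; ring.
exists (- red a r); apply: (mulfI (lform_neq0 (sxi xi (mem_head _ _)).1)).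
have := congr1 (red a) wr; rewrite /w rmorphB !rmorphM /= !red_lform.
rewrite (proj_self a0) linear0 mul0r sub0r /prod_lform big_cons rmorphM /=.
rewrite red_lform rmorph_prod big_map /= => /(congr1 -%R); rewrite opprK => ->.
under eq_bigr do rewrite red_lform.
by ring.
Qed.

(** Hyperplanes have the same trace on that of [a] when their forms project to
    the same line [X]; one of them is dropped because of the spare factor in
    [same_line_dvd]. *)
Definition line_rest a T (X : {vspace V}) : seq V :=
  [seq proj a g | g <- behead [seq g <- T | <[proj a g]>%VS == X]].

(** Forms with different traces on the hyperplane of [a] remain coprime after
    restriction to it. *)
Lemma lines_dvd a T theta (K : seq {vspace V}) : a != 0 -> uniq K ->
    uniq T -> 0 \notin T ->
    {in T &, forall g g', g != g' -> proj g g' != 0} ->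
    {in T, forall g, proj a g != 0} ->
    in_D (root_arrangement T) theta ->
  mdvd (prod_lform (flatten (map (line_rest a T) K))) (red a (theta (lform a))).
Proof.
move=> a0 + uT T0 Tpair aT /(in_D_lform _ T0)[d dT].
have restP X v : v \in line_rest a T X ->
    exists2 g, g \in T & v = proj a g /\ <[proj a g]>%VS = X.
  case/mapP => g /mem_behead; rewrite mem_filter => /andP[/eqP gX Tg] ->.
  by exists g.
elim: K => [|X K IHK] /=.
  rewrite /prod_lform big_nil; exists (red a (theta (lform a))).
  by rewrite mul1r.
move=> /andP[XK /IHK{}IHK].
rewrite /prod_lform big_cat /= -/(prod_lform _) -/(prod_lform _) mulrC.
apply: mdvd_prod_coprime => //.
  rewrite /line_rest.
  case E : [seq g <- T | <[proj a g]>%VS == X] => [|xi s] /=.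
    rewrite /prod_lform big_nil; exists (red a (theta (lform a))).
    by rewrite mul1r.
  have inT g : g \in xi :: s -> g \in T /\ <[proj a g]>%VS = X.
    by rewrite -E mem_filter => /andP[/eqP].
  apply: (@same_line_dvd a xi s) => //.
  - by rewrite -E filter_uniq.
  - by apply/negP => /inT[/(negP T0)].
  - by move=> g g' /inT[Tg _] /inT[Tg' _]; apply: Tpair.
  - move=> g /inT[Tg gX]; split; first exact: aT.
    by have [_ ->] := inT xi (mem_head _ _); rewrite -gX memv_line.
  - by move=> g /inT[Tg _]; apply: dT.
move=> v /restP[g Tg [-> gX]]; split; first exact: aT.
move=> /(mdvd_prod_lform (aT g Tg))[v' /flattenP[_ /mapP[X' KX' ->]]].
case/restP => g' Tg' [-> g'X'] /proj_eq0P[c gc].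
have c0 : c != 0.
  by apply: contraNneq (aT g' Tg') => c0; rewrite gc c0 scale0r.
move/negP: XK; apply; suff -> : X = X' by [].
by rewrite -gX -g'X' gc; apply/vspaceP => u; apply/vlineP/vlineP => -[k ->];
  [exists (k / c); rewrite scalerA divfK | exists (k * c); rewrite scalerA].
Qed.

Lemma size_line_rest a T X :
  size (line_rest a T X) = (count (fun g => <[proj a g]>%VS == X) T).-1.
Proof. by rewrite size_map size_behead size_filter. Qed.

Lemma value_bound_lines a T h (K : seq {vspace V}) : a != 0 -> uniq K ->
    uniq T -> 0 \notin T ->
    {in T &, forall g g', g != g' -> proj g g' != 0} ->
    {in T, forall g, proj a g != 0} ->
    (h <= \sum_(X <- K) (count (fun g => <[proj a g]>%VS == X) T).-1)%N ->
  value_bound T h a.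
Proof.
move=> a0 uK uT T0 Tpair aT hK.
exists (prod_lform (flatten (map (line_rest a T) K))).
exists (size (flatten (map (line_rest a T) K))); split.
- exact: prod_lform_homog.
- rewrite size_flatten /shape -map_comp sumnE big_map.
  by under eq_bigr do rewrite /= size_line_rest.
- by move=> theta thetaT; apply: lines_dvd.
Qed.

End ValueBound.

(** * Root systems ordered by a linear functional *)

Section Reflections.
Variables (R : realType) (l : nat).
Notation V := 'rV[R]_l.
Implicit Types (u v w a b d g : V) (c : R) (s Psi : seq V).

Lemma int_gt0_cases c : c \is a Num.int -> 0 < c -> c = 1 \/ 2 <= c.
Proof.
case/intrP => z ->; rewrite ltr0z => z0.
have [->|z1] := eqVneq z 1; first by left.
right; rewrite (ler_int R 2 z) -[2]/(1 + 1) lez1D.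
by rewrite lt_def z1 -gtz0_ge1.
Qed.

Definition refl a b := b - cartan b a *: a.

Lemma cartanD u v a : cartan (u + v) a = cartan u a + cartan v a.
Proof. by rewrite /cartan dotDl mulrDr mulrDl. Qed.

Lemma cartanB u v a : cartan (u - v) a = cartan u a - cartan v a.
Proof. by rewrite /cartan dotBl mulrBr mulrBl. Qed.

Lemma cartanZ c u a : cartan (c *: u) a = c * cartan u a.
Proof. by rewrite /cartan dotZl mulrCA !mulrA. Qed.

Lemma cartan_self a : a != 0 -> cartan a a = 2.
Proof. by rewrite -dot_eq0 => a0; rewrite /cartan mulfK. Qed.

Lemma cartan_gt0 u a : a != 0 -> (0 < cartan u a) = (0 < dot u a).
Proof.
by rewrite -dot_gt0 => a0; rewrite /cartan pmulr_lgt0 ?invr_gt0 ?pmulr_rgt0.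
Qed.

Lemma dot_cartan u a : a != 0 -> 2 * dot u a = cartan u a * dot a a.
Proof. by rewrite -dot_eq0 => a0; rewrite /cartan divfK. Qed.

Lemma refl_self a : a != 0 -> refl a a = - a.
Proof.
by move=> a0; rewrite /refl cartan_self // scaler_nat mulr2n opprD addNKr.
Qed.

Lemma dot_refl a u v : a != 0 -> dot (refl a u) (refl a v) = dot u v.
Proof.
move=> a0; have a0' : dot a a != 0 by rewrite dot_eq0.
rewrite /refl dotBl !linearB /= !linearZ !dotZl /= (dotC a v) /cartan.
by rewrite !dotZl; field.
Qed.

Lemma reflK a : a != 0 -> involutive (refl a).
Proof.
move=> a0 u; have : cartan (refl a u) a = - cartan u a.
  by rewrite /refl cartanB cartanZ cartan_self //; ring.
by rewrite {2}/refl => ->; rewrite scaleNr opprK /refl subrK.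
Qed.

Lemma cartan_refl a b : a != 0 -> cartan a (refl a b) = - cartan a b.
Proof.
move=> a0; rewrite {1}/cartan dot_refl // -[a in dot a _](reflK a0) dot_refl //.
by rewrite refl_self // dotNl /cartan mulrN mulNr.
Qed.

(** The axioms of a root system in its linear span, so that they pass to
    subsystems. Lists have no repetitions, for the sake of sums over roots. *)
Definition reflection_system Psi :=
  [/\ uniq Psi, 0 \notin Psi,
      forall a c, a \in Psi -> c *: a \in Psi -> c = 1 \/ c = -1,
      forall a b, a \in Psi -> b \in Psi -> refl a b \in Psi
    & forall a b, a \in Psi -> b \in Psi -> cartan b a \is a Num.int].

Lemma filter_reflection_system Psi (P : pred V) : reflection_system Psi ->
    {in Psi &, forall a b, P a -> P b -> P (refl a b)} ->
  reflection_system (filter P Psi).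
Proof.
case=> uPsi Psi0 red reflP intP closedP; split.
- exact: filter_uniq.
- by rewrite mem_filter (negPf Psi0) andbF.
- by move=> a c; rewrite !mem_filter => /andP[_ aP] /andP[_]; apply: red.
- move=> a b; rewrite !mem_filter => /andP[Pa aP] /andP[Pb bP].
  by rewrite reflP // closedP.
- by move=> a b; rewrite !mem_filter => /andP[_ aP] /andP[_]; apply: intP.
Qed.

Section System.
Variable Psi : seq V.
Hypothesis sys : reflection_system Psi.

Lemma root_neq0 a : a \in Psi -> a != 0.
Proof. by case: sys => _ Psi0 _ _ _; apply: contraTneq => ->. Qed.

Lemma rootN a : a \in Psi -> - a \in Psi.
Proof.
by case: sys => _ _ _ reflP _ aP; rewrite -refl_self ?root_neq0 ?reflP.
Qed.

Lemma root_double a : a \in Psi -> a + a \notin Psi.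
Proof.
case: sys => _ _ red _ _ aP; apply/negP => aaP.
by have [|c2|c2] := red a 2 aP; rewrite ?scaler_nat ?mulr2n //; lra.
Qed.

(** If one of the Cartan integers is [1], then [a - b] or its opposite is a
    reflected root. Otherwise both are at least [2], so that equality holds in
    the Cauchy-Schwarz inequality and the roots are proportional. *)
Lemma rootB a b : a \in Psi -> b \in Psi -> a != b -> 0 < dot a b ->
  a - b \in Psi.
Proof.
move=> aP bP ab dab; have [_ _ red reflP intP] := sys.
have [a0 b0] := (root_neq0 aP, root_neq0 bP).
have cab : 0 < cartan a b by rewrite cartan_gt0.
have cba : 0 < cartan b a by rewrite cartan_gt0 // dotC.
have [c1|c1] := int_gt0_cases (intP b a bP aP) cab.
  by have := reflP b a bP aP; rewrite /refl c1 scale1r.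
have [c2|c2] := int_gt0_cases (intP a b aP bP) cba.
  by rewrite -opprB rootN //; have := reflP a b aP bP; rewrite /refl c2 scale1r.
have [c bc] : exists c, b = c *: a.
  apply: proj_eq0P; apply/eqP; rewrite -dot_eq0 eq_le dot_ge0 andbT.
  have aa0 : dot a a != 0 by rewrite dot_eq0.
  have -> : dot (proj a b) (proj a b)
      = (dot b b * dot a a - dot a b ^+ 2) / dot a a.
    rewrite [X in dot X _]/proj dotBl dotZl dot_proj // mulr0 subr0.
    by rewrite /proj linearB linearZ /= (dotC b a); field.
  rewrite pmulr_lle0 ?invr_gt0 ?dot_gt0 // subr_le0.
  have h1 : 2 * dot b b <= 2 * dot a b.
    by rewrite [leRHS](dot_cartan _ b0) ler_wpM2r ?dot_ge0.
  have h2 : 2 * dot a a <= 2 * dot a b.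
    by rewrite (dotC a b) [leRHS](dot_cartan _ a0) ler_wpM2r ?dot_ge0.
  by have := dot_ge0 a; have := dot_ge0 b; nra.
have [||c1'] := red a c aP; rewrite -?bc //.
  by move=> c1'; rewrite bc c1' scale1r eqxx in ab.
by move: dab; rewrite bc c1' linearZ /= mulN1r oppr_gt0 ltNge dot_ge0.
Qed.

Variable f : {scalar V}.
Hypothesis f_neq0 : {in Psi, forall a, f a != 0}.

Definition pos_part := [seq b <- Psi | 0 < f b].

Lemma pos_partP b : reflect (b \in Psi /\ 0 < f b) (b \in pos_part).
Proof. by rewrite mem_filter andbC; apply: andP. Qed.

Lemma pos_part_uniq : uniq pos_part.
Proof. by case: sys => u _ _ _ _; apply: filter_uniq. Qed.

Lemma pos_or_neg b : b \in Psi -> b \in pos_part \/ - b \in pos_part.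
Proof.
move=> bP; have := f_neq0 bP; rewrite neq_lt => /orP[b0|b0].
  by right; apply/pos_partP; rewrite rootN // linearN oppr_gt0.
by left; apply/pos_partP.
Qed.

Lemma pos_proj a b : a \in pos_part -> b \in pos_part -> a != b ->
  proj a b != 0.
Proof.
move=> /pos_partP[aP a0] /pos_partP[bP b0] ab; have [_ _ red _ _] := sys.
apply/eqP => /proj_eq0P[c bc].
have [||c1] := red a c aP; rewrite -?bc //.
  by move=> c1; rewrite bc c1 scale1r eqxx in ab.
by move: b0; rewrite bc c1 linearZ /= mulN1r oppr_gt0 ltNge ltW.
Qed.

Lemma level_obtuse a b : a \in Psi -> b \in Psi -> f a = f b -> a != b ->
  dot a b <= 0.
Proof.
move=> aP bP fab ab; rewrite leNgt; apply/negP => /(rootB aP bP ab) /f_neq0.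
by rewrite linearB /= fab subrr eqxx.
Qed.

Definition indecomposable a :=
  (a \in pos_part) && all (fun b => a - b \notin pos_part) pos_part.

Lemma indecomposableP a b : indecomposable a -> b \in pos_part ->
  a - b \notin pos_part.
Proof. by case/andP => _ /allP /[apply]. Qed.

Lemma indecomposable_sub a b : indecomposable a -> b \in pos_part -> b != a ->
  0 < dot b a -> b - a \in pos_part.
Proof.
move=> ia bp ba dba; have /andP[ap _] := ia.
have /pos_or_neg[//|] : b - a \in Psi.
  by move: ap bp => /pos_partP[aP _] /pos_partP[bP _]; apply: rootB.
by rewrite opprB (negPf (indecomposableP ia bp)).
Qed.

(** A simple reflection permutes the other positive roots. The induction is on
    an upper bound for [cartan b a]: if that integer is positive then [b - a] is
    a positive root, and were [refl a b] negative, [a] would be the sum of the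
    positive roots [refl a (b - a)] and [- refl a b]. *)
Lemma refl_indecomposable a b : indecomposable a -> b \in pos_part -> b != a ->
  refl a b \in pos_part.
Proof.
move=> ia; have /andP[ap _] := ia; have [aP fa] := pos_partP a ap.
have a0 := root_neq0 aP; have [_ _ _ reflP _] := sys.
suff main n : forall b, b \in pos_part -> b != a -> cartan b a <= n%:R ->
    refl a b \in pos_part.
  move=> bp ba; have [c0|c0] := leP (cartan b a) 0; first exact: (main 0%N).
  by apply: main bp ba (ltW _); apply: archi_boundP; apply: ltW.
elim: n => [|n IHn] {}b bp ba bn; have [bP fb] := pos_partP b bp.
  apply/pos_partP; split; first exact: reflP.
  by rewrite linearB linearZ /=; nra.
have [c0|c0] := leP (cartan b a) 0.
  apply/pos_partP; split; first exact: reflP.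
  by rewrite linearB linearZ /=; nra.
have bap : b - a \in pos_part.
  by apply: indecomposable_sub => //; rewrite -cartan_gt0.
have baa : b - a != a.
  apply: contraTneq bP => /eqP; rewrite subr_eq => /eqP ->.
  exact: root_double.
have := IHn _ bap baa; rewrite cartanB cartan_self // => /(_ _) rba.
have {rba} : refl a (b - a) \in pos_part.
  by apply: rba; move: bn; rewrite -natr1; lra.
have -> : refl a (b - a) = a - (- refl a b).
  rewrite /refl cartanB cartan_self //; apply/rowP => i; rewrite !mxE; ring.
have [//|Nrp] := pos_or_neg (reflP a b aP bP).
by rewrite (negPf (indecomposableP ia Nrp)).
Qed.

(** The reflection in [a] permutes the positive roots other than [a] and changes
    the sign of their contributions, which therefore cancel. *)
Lemma sum_cartan_indecomposable a : indecomposable a ->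
  \sum_(b <- pos_part) cartan a b = 2.
Proof.
move=> ia; have /andP[ap _] := ia; have [aP fa] := pos_partP a ap.
have a0 := root_neq0 aP.
rewrite (bigD1_seq a) ?pos_part_uniq //= cartan_self // -big_filter.
set rest := filter _ _.
have rest_refl b : b \in rest -> refl a b \in rest.
  rewrite mem_filter => /andP[ba bp]; rewrite mem_filter refl_indecomposable //.
  rewrite andbT.
  apply: contraTneq bp => ra; apply/pos_partP => -[_].
  by rewrite -(reflK a0 b) ra refl_self // linearN oppr_gt0 ltNge ltW.
have rest_perm : perm_eq rest (map (refl a) rest).
  have urest : uniq rest by rewrite filter_uniq ?pos_part_uniq.
  apply: uniq_perm => //.
    by rewrite map_inj_uniq //; apply: inv_inj (reflK a0).
  move=> b; apply/idP/mapP => [bp|[b' b'p ->]]; last exact: rest_refl.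
  by exists (refl a b); rewrite ?rest_refl ?reflK.
have : \sum_(b <- rest) cartan a b = - \sum_(b <- rest) cartan a b.
  rewrite -sumrN [LHS](perm_big _ rest_perm) big_map.
  by apply: eq_bigr => b _; rewrite cartan_refl.
lra.
Qed.

Lemma sum_cartan_span s (k : {scalar V}) c v :
    {in s, forall a, indecomposable a /\ k a = c} -> v \in <<s>>%VS ->
  c * \sum_(b <- pos_part) cartan v b = 2 * k v.
Proof.
move=> sP; rewrite -[s]/(tval (in_tuple s)) => /coord_span ->.
have lin (I : Type) (r : seq I) (F : I -> V) b :
    cartan (\sum_(i <- r) F i) b = \sum_(i <- r) cartan (F i) b.
  elim/big_rec2: _ => [|i x y _ <-]; last by rewrite cartanD.
  by rewrite /cartan dot0l mulr0 mul0r.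
under eq_bigr do rewrite lin.
rewrite exchange_big linear_sum !mulr_sumr; apply: eq_bigr => i _.
under eq_bigr do rewrite cartanZ.
have [|si kc] := sP (tnth (in_tuple s) i); first exact: mem_tnth.
rewrite -!(tnth_nth 0) -mulr_sumr sum_cartan_indecomposable //.
by rewrite linearZ /= kc; ring.
Qed.

Definition low a := count (fun b => f b < f a) pos_part.

Lemma low_ge a s : uniq s -> {subset s <= pos_part} ->
  {in s, forall b, f b < f a} -> (size s <= low a)%N.
Proof.
move=> us sp sa; rewrite /low -size_filter; apply: uniq_leq_size => // b sb.
by rewrite mem_filter sa // sp.
Qed.

Lemma low_lt a b : b \in pos_part -> f b < f a -> (low b < low a)%N.
Proof.
move=> bp fba; have := @low_ge a (b :: [seq d <- pos_part | f d < f b]).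
rewrite /= size_filter -/(low b); apply.
- by rewrite filter_uniq ?pos_part_uniq // mem_filter ltxx.
- by move=> d; rewrite inE mem_filter => /predU1P[-> //|/andP[]].
- move=> d; rewrite inE mem_filter => /predU1P[-> //|/andP[db _]].
  exact: lt_trans fba.
Qed.

Lemma pos_sum_indecomposable a : a \in pos_part ->
  exists s, all indecomposable s /\ a = \sum_(d <- s) d.
Proof.
have [n] := ubnP (low a); elim: n a => // n IHn a /ltnSE an ap.
have [ia|] := boolP (indecomposable a).
  by exists [:: a]; rewrite /= ia big_seq1.
rewrite /indecomposable ap /= => /allPn[b bp]; rewrite negbK => abp.
have IH d : d \in pos_part -> a - d \in pos_part ->
    exists s, all indecomposable s /\ d = \sum_(d <- s) d.
  move=> dp /pos_partP[_ ad]; apply: IHn => //; apply: leq_trans an.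
  by apply: low_lt => //; rewrite -subr_gt0 -linearB.
have [s [si bs]] := IH b bp abp.
have [|t [ti abt]] := IH (a - b) abp; first by rewrite subKr.
exists (s ++ t); rewrite all_cat si ti; split=> //.
by rewrite big_cat /= -bs -abt addrC subrK.
Qed.

(** The height of [a], which is half of the sum of the [cartan a b], exceeds
    the number of positive roots below [a] only if [a] is simple: removing one
    simple root at a time from [a] produces enough of them. *)
Lemma height_low a : a \in pos_part ->
  \sum_(b <- pos_part) cartan a b - 2 <= 2 * (low a).-1%:R.
Proof.
have [n] := ubnP (low a); elim: n a => // n IHn a /ltnSE an ap.
have [ia|nia] := boolP (indecomposable a).
  by rewrite sum_cartan_indecomposable // subrr mulr_ge0.
have [aP fa] := pos_partP a ap.
have [s [/allP si as_]] := pos_sum_indecomposable ap.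
have [d ds dad] : exists2 d, d \in s & 0 < dot a d.
  apply/hasP; apply: contraTT (root_neq0 aP) => /hasPn s0.
  rewrite -dot_gt0 [X in dot _ X]as_ linear_sum /= -leNgt big_seq.
  by apply: sumr_le0 => d ds; rewrite leNgt s0.
have id := si d ds; have /andP[dp _] := id; have [dP fd] := pos_partP d dp.
have ad : a != d by apply: contraNneq nia => ->.
have a'p : a - d \in pos_part by apply: indecomposable_sub.
have fa' : f (a - d) < f a by rewrite linearB /= gtrBl.
have fda : f d < f a by move/pos_partP: a'p => [_]; rewrite linearB subr_gt0.
have sumE : \sum_(b <- pos_part) cartan a b
    = \sum_(b <- pos_part) cartan (a - d) b + 2.
  rewrite -(sum_cartan_indecomposable id) -big_split /=.
  by apply: eq_bigr => b _; rewrite -cartanD subrK.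
have lt_low := low_lt a'p fa'.
have := IHn _ (leq_trans lt_low an) a'p; rewrite sumE addrK.
have [low0|low0] := posnP (low (a - d)).
  have : (2 <= low a)%N.
    apply: (@low_ge a [:: a - d; d]) => [|b|b].
    - rewrite /= inE andbT; apply: contraTneq aP => /eqP; rewrite subr_eq.
      by move/eqP => ->; apply: root_double.
    - by rewrite !inE => /orP[]/eqP ->.
    - by rewrite !inE => /orP[]/eqP ->.
  rewrite low0 /= => low2 h.
  have : 1 <= (low a).-1%:R :> R by rewrite ler1n; case: (low a) low2 => [|[]].
  lra.
move=> h; have : (low (a - d)).-1%:R + 1 <= (low a).-1%:R :> R.
  by rewrite natr1 ler_nat prednK //; case: (low a) lt_low.
lra.
Qed.

End System.

(** In a linear relation, the part [u] with positive coefficients is the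
    opposite of the rest, so that [dot u u <= 0] by obtuseness. Hence [u = 0],
    and as [f] is positive on [s] no coefficient was positive. *)
Lemma obtuse_free s (f : {scalar V}) : uniq s ->
    {in s &, forall a b, a != b -> dot a b <= 0} ->
    {in s, forall a, 0 < f a} ->
  free s.
Proof.
move=> us obt f0; rewrite -[s]/(tval (in_tuple s)); apply/freeP.
suff main k : \sum_(i < size s) k i *: (in_tuple s)`_i = 0 ->
    forall i, k i <= 0.
  move=> k k0 i; apply/eqP; rewrite eq_le main //= -oppr_le0.
  apply: (main (fun i => - k i)); under eq_bigr do rewrite scaleNr.
  by rewrite sumrN k0 oppr0.
move=> k0 i; rewrite leNgt; apply/negP => ki.
pose u := \sum_(i < size s | 0 < k i) k i *: (in_tuple s)`_i.
pose w := \sum_(i < size s | ~~ (0 < k i)) k i *: (in_tuple s)`_i.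
have uw : u + w = 0 by rewrite -[RHS]k0 [RHS](bigID (fun i => 0 < k i)).
have u0 : u = 0.
  apply/eqP; rewrite -dot_eq0 eq_le dot_ge0 andbT.
  have -> : dot u u = - dot u w.
    by rewrite -linearN; congr dot; apply/eqP; rewrite -addr_eq0 uw.
  rewrite oppr_le0 dot_suml sumr_ge0 // => j kj; rewrite linear_sum sumr_ge0 //.
  move=> j' kj' /=; rewrite dotZl linearZ /= mulr_ge0 ?(ltW kj) //.
  have kj'0 : k j' <= 0 by rewrite leNgt.
  rewrite mulr_le0 // obt ?mem_nth ?size_tuple //.
  rewrite nth_uniq ?size_tuple //.
  by apply: contraNneq kj' => /val_inj <-.
have : 0 < f u.
  rewrite linear_sum (bigD1 i) //= ltr_wpDr //.
    apply: sumr_ge0 => j /andP[kj _]; rewrite linearZ mulr_ge0 ?(ltW kj) //.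
    by rewrite ltW // f0 ?mem_nth ?size_tuple.
  by rewrite linearZ mulr_gt0 // f0 ?mem_nth ?size_tuple.
by rewrite u0 linear0 ltxx.
Qed.

End Reflections.

(** * Roots of equal value *)

Section Levels.
Variables (R : realType) (l : nat).
Notation V := 'rV[R]_l.
Implicit Types (u v w a b d g : V) (s Psi : seq V).
Variable Psi : seq V.
Hypothesis sys : reflection_system Psi.
Variable f : {scalar V}.
Hypothesis f_neq0 : {in Psi, forall a, f a != 0}.

Section LevelSet.
Variables (s : seq V) (c : R).
Hypotheses (us : uniq s) (sPsi : {subset s <= Psi}).
Hypotheses (c0 : 0 < c) (sc : {in s, forall b, f b = c}).

Lemma level_free : free s.
Proof.
apply: (@obtuse_free _ _ _ f) => // [a b sa sb|a sa]; last by rewrite sc.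
by apply: (level_obtuse sys f_neq0); rewrite ?sPsi // !sc.
Qed.

(** The roots of the span of [s] with integral relative value [f a / c] form a
    subsystem, in which the elements of [s] are simple because they have the
    least possible positive value. Hence on the span of [s] the sum of the
    positive coroots of this subsystem is [2 * f / c], and coroots take integral
    values on roots. *)
Lemma level_half_integral g : g \in Psi -> g \in <<s>>%VS ->
  2 * f g / c \is a Num.int.
Proof.
move=> gP gs; have [_ _ _ reflP intP] := sys.
pose Psi1 := [seq a <- Psi | (a \in <<s>>%VS) && (f a / c \is a Num.int)].
have Psi1P a : a \in Psi1 ->
    [/\ a \in Psi, a \in <<s>>%VS & f a / c \is a Num.int].
  by rewrite mem_filter => /andP[/andP[]].
have sys1 : reflection_system Psi1.
  apply: filter_reflection_system => // a b aP bP /andP[as_ ai] /andP[bs bi].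
  rewrite /refl rpredB ?rpredZ //= linearB linearZ /= mulrBl -mulrA.
  by rewrite rpredB // rpredM // intP.
have f1 : {in Psi1, forall a, f a != 0} by move=> a /Psi1P[/f_neq0].
have s1 : {subset s <= Psi1}.
  move=> b sb; rewrite mem_filter sPsi // memv_span // sc // divff ?gt_eqF //.
  by rewrite rpred1.
have s_indec : {in s, forall a, indecomposable Psi1 f a /\ f a = c}.
  move=> b sb; split; last exact: sc.
  apply/andP; split; first by apply/pos_partP; rewrite s1 ?sc.
  apply/allP => d /pos_partP[/Psi1P[_ _ di] fd]; apply/pos_partP => -[_].
  rewrite linearB /= sc // subr_gt0 ltNge => /negP; apply.
  have d0 : 0 < f d / c by rewrite divr_gt0.
  have : 1 <= f d / c by case: (int_gt0_cases di d0) => [->|]; lra.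
  by rewrite ler_pdivlMr // mul1r.
rewrite -(sum_cartan_span sys1 f1 s_indec gs) mulrAC divff ?gt_eqF // mul1r.
rewrite big_seq; apply: rpred_sum => b /pos_partP[/Psi1P[bP _ _] _].
exact: intP.
Qed.

(** The edge bound for Dynkin diagrams: if [a + b] is a root then the angle
    between [a] and [b] is at least 120 degrees. The inner product is not zero,
    since otherwise [b - a], the reflection of [a + b], would be a root with
    value [0]. *)
Lemma scaled_pair a b : a \in Psi -> b \in Psi -> f a = f b ->
    a != b -> a + b \in Psi ->
  dot a b / (Num.sqrt (dot a a) * Num.sqrt (dot b b)) <= - 2^-1.
Proof.
move=> aP bP fab ab abP; have [_ _ _ reflP intP] := sys.
have [a0 b0] := (root_neq0 sys aP, root_neq0 sys bP).
have dab : dot a b < 0.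
  rewrite lt_neqAle (level_obtuse sys f_neq0) // andbT; apply/eqP => dab.
  have := reflP a (a + b) aP abP; rewrite /refl cartanD cartan_self //.
  rewrite /cartan dotC dab mulr0 mul0r addr0 => /f_neq0.
  rewrite linearB linearD linearZ /= fab => /eqP; apply; ring.
have le (x y : V) : x != 0 -> cartan y x \is a Num.int -> dot y x < 0 ->
    2 * dot y x <= - dot x x.
  move=> x0 ci yx; rewrite (dot_cartan _ x0) -mulN1r ler_wpM2r ?dot_ge0 //.
  have : 1 <= - cartan y x.
    have c_neg : 0 < - cartan y x.
      rewrite oppr_gt0 -(pmulr_llt0 _ (x := dot x x)) ?dot_gt0 //.
      by rewrite -dot_cartan //; lra.
    by case: (int_gt0_cases _ c_neg) => [||]; rewrite ?rpredN //; lra.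
  lra.
have h1 := le b a b0 (intP b a bP aP) dab.
have h2 : 2 * dot a b <= - dot a a.
  by rewrite dotC; apply: le => //; [apply: intP | rewrite dotC].
have sa : 0 < Num.sqrt (dot a a) by rewrite sqrtr_gt0 dot_gt0.
have sb : 0 < Num.sqrt (dot b b) by rewrite sqrtr_gt0 dot_gt0.
rewrite ler_pdivrMr ?mulr_gt0 //.
have := sqr_sqrtr (dot_ge0 a); have := sqr_sqrtr (dot_ge0 b).
by set x := Num.sqrt _; set y := Num.sqrt _ => hx hy; nra.
Qed.

(** A lower root would have value [c / 2]. Let [D] be the set of roots of the
    span with this value, [s2] the set of elements of [s] that are sums of two
    elements of [D], and [s1] its complement in [s]. Independence of [D ++ s1]
    gives [#|D| <= #|s2|]. Expanding the squared norm of the sum [u] of the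
    normalized elements of [D] gives [#|s2| < #|D|]. *)
Lemma level_lowest g : g \in Psi -> g \in <<s>>%VS -> 0 < f g -> c <= f g.
Proof.
move=> gP gs fg; rewrite leNgt; apply/negP => fgc.
have [_ _ _ reflP intP] := sys.
pose D := [seq a <- Psi | (a \in <<s>>%VS) && (f a == c / 2)].
have DP a : a \in D -> [/\ a \in Psi, a \in <<s>>%VS & f a = c / 2].
  by rewrite mem_filter => /andP[/andP[? /eqP]].
have uD : uniq D by case: sys => u _ _ _ _; apply: filter_uniq.
have gD : g \in D.
  rewrite mem_filter gP gs andbT /=; apply/eqP.
  have [||] := int_gt0_cases (level_half_integral gP gs).
  - by rewrite divr_gt0 ?mulr_gt0.
  - by move/(congr1 ( *%R^~ c)); rewrite divfK ?gt_eqF //; lra.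
  - by rewrite ler_pdivlMr //; lra.
pose sumD := [pred b | has (fun d => b - d \in D) D].
pose s1 := [seq b <- s | ~~ sumD b]; pose s2 := [seq b <- s | sumD b].
have s1s d : d \in s1 -> d \in s by rewrite mem_filter => /andP[].
have D_s : (size D <= size s2)%N.
  have : (size (D ++ s1) <= size s)%N.
    have /eqP <- : free (D ++ s1).
      apply: (@obtuse_free _ _ _ f) => [|a b|a].
      - rewrite cat_uniq uD filter_uniq // andbT; apply/hasPn => b.
        rewrite mem_filter => /andP[_ sb]; apply/negP => /DP[_ _].
        by rewrite sc //; lra.
      - have Ds1 d b' : d \in D -> b' \in s1 -> dot d b' <= 0.
          move=> dD; rewrite mem_filter => /andP[/hasPn/(_ d dD) bD sb].
          have [dP ds fd] := DP d dD.
          have bd : b' != d.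
            by apply/eqP => bd; move: fd; rewrite -bd sc //; lra.
          rewrite leNgt dotC; apply: contraNN bD => dbd.
          rewrite mem_filter linearB /= fd sc // rpredB ?(memv_span sb) //=.
          rewrite (rootB sys) ?(sPsi sb) ?andbT //.
          by apply/eqP; lra.
        rewrite !mem_cat => /orP[aD|as1] /orP[bD|bs1] ab.
        + have [aP _ fa] := DP a aD; have [bP _ fb] := DP b bD.
          by apply: (level_obtuse sys f_neq0); rewrite ?fa.
        + exact: Ds1.
        + by rewrite dotC; apply: Ds1.
        + apply: (level_obtuse sys f_neq0) => //; first exact/sPsi/s1s.
            exact/sPsi/s1s.
          by rewrite !sc ?s1s.
      - rewrite mem_cat => /orP[/DP[_ _ ->]|/s1s sa].
          by rewrite divr_gt0.
        by rewrite sc.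
    apply: leq_trans (dim_span s); apply: dimvS; apply/span_subvP => a.
    by rewrite mem_cat => /orP[/DP[]//|/s1s]; apply: memv_span.
  rewrite size_cat -(count_predC sumD s) -!size_filter -/s2.
  by rewrite leq_add2r.
pose n d := Num.sqrt (dot d d).
have n0 d : d \in D -> 0 < n d.
  by case/DP => dP _ _; rewrite sqrtr_gt0 dot_gt0 (root_neq0 sys).
pose u := \sum_(d <- D) (n d)^-1 *: d.
have u0 : 0 < dot u u.
  rewrite dot_gt0; apply: contraTneq (isT : true) => u0.
  have : 0 < f u.
    rewrite linear_sum (big_rem g) //= ltr_wpDr //.
      rewrite big_seq sumr_ge0 // => d /mem_rem dD; rewrite linearZ /=.
      have [_ _ ->] := DP d dD.
      by rewrite mulr_ge0 ?divr_ge0 ?ltW // invr_gt0 n0.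
    rewrite linearZ /=; have [_ _ ->] := DP g gD.
    by rewrite mulr_gt0 ?divr_gt0 ?invr_gt0 ?n0.
  by rewrite u0 linear0 ltxx.
(* Every sum in [s2] is counted at least twice, once for each order of its
   two terms, which are distinct since a root is not twice another root. *)
pose edges := (\sum_(d <- D) count (fun d' => (d + d')%R \in s2) D)%N.
have s2P b : b \in s2 -> [/\ b \in s, b \in Psi & sumD b].
  by rewrite mem_filter => /andP[sb bs]; split=> //; apply: sPsi.
have edges_ge : (2 * size s2 <= edges)%N.
  have -> : (2 * size s2 = \sum_(b <- s2) 2)%N.
    by rewrite big_const_seq count_predT iter_addn_0 mulnC.
  apply: (@leq_trans (\sum_(b <- s2) count (fun d => (b - d)%R \in D) D)%N).
    rewrite big_seq [leqRHS]big_seq; apply: leq_sum => b /s2P[_ bP].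
    case/hasP => d dD bdD; rewrite -size_filter.
    apply: (@uniq_leq_size _ [:: d; b - d]) => [|d'].
      rewrite /= inE andbT; apply: contraTneq bP => dbd.
      rewrite -[b](subrK d) -dbd (root_double sys) //.
      by have [] := DP d dD.
    rewrite !inE mem_filter => /orP[]/eqP ->; first by rewrite bdD.
    by rewrite subKr dD.
  under eq_bigr do rewrite -sum1_count big_mkcond.
  rewrite exchange_big; apply: leq_sum => d _.
  rewrite -big_mkcond sum1_count -!size_filter.
  rewrite -[leqLHS](size_map (fun b => b - d)); apply: uniq_leq_size.
    by rewrite (map_inj_uniq (@addIr V (- d))) ?filter_uniq.
  move=> _ /mapP[b + ->]; rewrite !mem_filter => /andP[-> /andP[sb bs]].
  by rewrite addrC subrK sb bs.
have : dot u u <= (size D)%:R - 2^-1 * edges%:R.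
  have -> : (size D)%:R - 2^-1 * edges%:R = \sum_(d <- D) \sum_(d' <- D)
      ((d == d')%:R - 2^-1 * (d + d' \in s2)%:R) :> R.
    under eq_bigr do rewrite sumrB -mulr_sumr.
    rewrite sumrB -mulr_sumr; congr (_ - _ * _).
      rewrite -sum1_size natr_sum; rewrite big_seq [RHS]big_seq.
      apply: eq_bigr => d dD; rewrite (bigD1_seq d) //= eqxx big1 ?addr0 //.
      by move=> d' /negPf; rewrite eq_sym => ->.
    rewrite natr_sum; apply: eq_bigr => d _.
    rewrite -sum1_count natr_sum big_mkcond /=.
    by apply: eq_bigr => d' _; case: ifP.
  rewrite /u dot_suml big_seq [leRHS]big_seq; apply: ler_sum => d dD.
  rewrite linear_sum /= big_seq [leRHS]big_seq; apply: ler_sum => d' dD'.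
  have -> : dot ((n d)^-1 *: d) ((n d')^-1 *: d') = dot d d' / (n d * n d').
    by rewrite linearZ /= dotZl mulrA -invfM [LHS]mulrC (mulrC (n d')).
  have [dP ds fd] := DP d dD; have [dP' ds' fd'] := DP d' dD'.
  have [<-|dd'] := eqVneq d d'.
    rewrite -expr2 sqr_sqrtr ?dot_ge0 // divff ?dot_eq0 ?(root_neq0 sys dP) //.
    case: (boolP (d + d \in s2)) => [/s2P[_ ddP _]|_]; last first.
      by rewrite mulr0 subr0.
    by have := root_double sys dP; rewrite ddP.
  case: (boolP (d + d' \in s2)) => [/s2P[_ abP _]|_]; last first.
    rewrite mulr0 subr0 pmulr_lle0 ?invr_gt0 ?mulr_gt0 ?n0 //.
    by apply: (level_obtuse sys f_neq0); rewrite ?fd.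
  by rewrite sub0r mulr1; apply: scaled_pair; rewrite ?fd.
have : (size D)%:R <= (size s2)%:R :> R by rewrite ler_nat.
have : 2 * (size s2)%:R <= edges%:R :> R by rewrite -natrM ler_nat.
lra.
Qed.

End LevelSet.

Lemma big_fibers (I J : eqType) (r : seq I) (k : I -> J) (F : I -> R) :
  \sum_(i <- r) F i
    = \sum_(j <- undup (map k r)) \sum_(i <- r | k i == j) F i.
Proof.
under [RHS]eq_bigr do rewrite big_mkcond.
rewrite exchange_big /= big_seq [RHS]big_seq; apply: eq_bigr => i ri.
rewrite (bigD1_seq (k i)) ?undup_uniq //= ?mem_undup ?map_f // eqxx.
by rewrite big1 ?addr0 // => j /negPf; rewrite eq_sym => ->.
Qed.

(** The sum of Cartan integers splits along the planes through [a], that is,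
    along the lines spanned by the vectors [proj a b]. The roots in one plane
    are a root system, to which [height_low] applies. *)
Lemma value_bound_root a h : a \in pos_part Psi f ->
    2 * h%:R <= \sum_(b <- pos_part Psi f) cartan a b - 2 ->
  value_bound [seq g <- pos_part Psi f | f g < f a] h a.
Proof.
move=> ap hs; set pos := pos_part Psi f in ap hs *.
have [aP fa] := pos_partP _ _ _ ap; have a0 := root_neq0 sys aP.
have upos : uniq pos := pos_part_uniq sys f.
pose key g := <[proj a g]>%VS.
pose K := undup (map key [seq b <- pos | b != a]).
have posP g : g \in [seq b <- pos | f b < f a] -> g \in pos /\ a != g.
  rewrite mem_filter => /andP[fg gp]; split=> //.
  by apply: contraTneq fg => ->; rewrite ltxx.
apply: (@value_bound_lines _ _ a _ h K) => //.
- exact: undup_uniq.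
- exact: filter_uniq.
- by apply/negP => /posP[/pos_partP[/(root_neq0 sys)]]; rewrite eqxx.
- by move=> g g' /posP[gp _] /posP[gp' _]; apply: (pos_proj sys) gp gp'.
- by move=> g /posP[gp ag]; apply: (pos_proj sys) ap gp ag.
rewrite -(ler_nat R) -(ler_pM2l (x := 2)) //; apply: (le_trans hs).
rewrite (bigD1_seq a) //= cartan_self // addrAC subrr add0r -big_filter.
rewrite (big_fibers _ key) -/K natr_sum mulr_sumr.
rewrite big_seq [leRHS]big_seq; apply: ler_sum => X.
rewrite mem_undup => /mapP[b0 b0p ->{X}].
have keyE b : b \in pos -> b != a ->
    (proj a b \in key b0) = (key b == key b0).
  move=> bp ba; apply/idP/eqP => [/vlineP[c bc]|<-]; last exact: memv_line.
  have bp0 : proj a b != 0 by apply: (pos_proj sys) ap bp _; rewrite eq_sym.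
  have c0 : c != 0 by apply: contraNneq bp0 => c0; rewrite bc c0 scale0r.
  rewrite /key bc; apply/vspaceP => u.
  by apply/vlineP/vlineP => -[k ->];
    [exists (k * c) | exists (k / c)]; rewrite scalerA ?divfK.
pose PsiX := [seq g <- Psi | proj a g \in key b0].
have sysX : reflection_system PsiX.
  apply: filter_reflection_system => // u v _ _ uX vX.
  by rewrite /refl linearB linearZ /= rpredB ?rpredZ.
have fX : {in PsiX, forall g, f g != 0}.
  by move=> g; rewrite mem_filter => /andP[_ /f_neq0].
have posX : pos_part PsiX f = [seq g <- pos | proj a g \in key b0].
  rewrite /pos_part /PsiX /pos /pos_part -!filter_predI.
  by apply: eq_filter => g /=; rewrite andbC.
have apX : a \in pos_part PsiX f by rewrite posX mem_filter proj_self // mem0v.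
have sumE : \sum_(b <- [seq b <- pos | b != a] | key b == key b0) cartan a b
    = \sum_(b <- pos_part PsiX f | b != a) cartan a b.
  rewrite posX big_filter_cond [RHS]big_filter_cond.
  rewrite big_seq_cond [RHS]big_seq_cond.
  apply: eq_bigl => b; case: (boolP (b \in pos)) => //= bp.
  by have [|ba] := eqVneq b a; rewrite ?andbF // andbT keyE.
have lowE : low PsiX f a
    = count (fun b => key b == key b0) [seq g <- pos | f g < f a].
  rewrite /low posX count_filter [RHS]count_filter.
  apply: eq_in_count => b bp /=.
  have [fba|_] := boolP (f b < f a); last by rewrite andbF.
  by rewrite andbT keyE //; apply: contraTneq fba => ->; rewrite ltxx.
have := height_low sysX fX apX; rewrite lowE.
rewrite (bigD1_seq a) ?(pos_part_uniq sysX) //= cartan_self //.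
by rewrite addrAC subrr add0r -sumE.
Qed.

End Levels.

(** * Heights *)

Section Height.
Variables (R : realType) (l : nat).
Notation V := 'rV[R]_l.
Implicit Types (u v w a b d g : V) (I s Phi : seq V) (Delta : l.-tuple V).

Definition height Delta v : R := \sum_i coord Delta i v.

Fact height_is_linear Delta : linear_for *%R (height Delta).
Proof.
move=> c u v; rewrite /height mulr_sumr -big_split /=.
by apply: eq_bigr => i _; rewrite linearP.
Qed.

HB.instance Definition _ Delta := GRing.isLinear.Build R V R *%R (height Delta)
  (height_is_linear Delta).

Lemma dim_hyperplane_of a : a != 0 -> (\dim (hyperplane_of a)).+1 = l.
Proof.
move=> a0; set phi := linfun (@mulmxr R 1 l 1 a^T).
have dim1 : \dim (limg phi) = 1%N.
  apply/eqP; rewrite eqn_leq; apply/andP; split.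
    by apply: leq_trans (dimvS (subvf _)) _; rewrite dimvf /dim /= mul1n.
  rewrite lt0n dimv_eq0; apply: contraNneq a0 => phi0.
  rewrite -dot_eq0 -mem_hyperplane_of memv_ker -memv0 -phi0.
  exact: memv_img (memvf a).
have := limg_ker_dim phi fullv.
by rewrite capfv dim1 addn1 dimvf /dim /= mul1n.
Qed.

Lemma in_D_eq_mem (A B : seq {vspace V}) theta : A =i B ->
  in_D A theta -> in_D B theta.
Proof. by move=> AB [d dA]; split=> // H p; rewrite -AB; apply: dA. Qed.

Lemma root_arrangement_eq_mem I s : I =i s ->
  root_arrangement I =i root_arrangement s.
Proof. exact: eq_mem_map. Qed.

Lemma value_bound_eq_mem I s h a : I =i s -> value_bound I h a ->
  value_bound s h a.
Proof.
move=> Is [b [d [bd hd bP]]]; exists b, d; split=> // theta thetas.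
apply: bP; apply: in_D_eq_mem thetas; apply: root_arrangement_eq_mem => v.
by rewrite Is.
Qed.

Section RootSystem.
Variables (Phi : seq V) (Delta : l.-tuple V).
Hypotheses (rPhi : is_root_system Phi) (sDelta : is_simple_system Phi Delta).

Lemma undup_reflection_system : reflection_system (undup Phi).
Proof.
case: rPhi => _ Phi0 red reflP intP; split.
- exact: undup_uniq.
- by rewrite mem_undup.
- by move=> a c; rewrite !mem_undup; apply: red.
- by move=> a b; rewrite !mem_undup; apply: reflP.
- by move=> a b; rewrite !mem_undup; apply: intP.
Qed.

Lemma coord_height0 v :
  (forall i, 0 <= coord Delta i v) -> height Delta v = 0 -> v = 0.
Proof.
move=> v0 /eqP; rewrite psumr_eq0 // => /allP hv.
have [/span_basis Dspan _ _] := sDelta.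
have vD : v \in <<Delta>>%VS by rewrite Dspan memvf.
rewrite (coord_span vD) big1 // => i _.
by have /= /eqP -> := hv i (mem_index_enum i); rewrite scale0r.
Qed.

Lemma root_height a : a \in Phi ->
  height Delta a != 0
  /\ (a \in positive_roots Phi Delta) = (0 < height Delta a).
Proof.
move=> aP; have [_ Phi0 _ _ _] := rPhi; have [_ _ /(_ a aP) nat_a] := sDelta.
have a0 : a != 0 by apply: contraNneq Phi0 => <-.
rewrite mem_filter aP andbT; case: nat_a => [na|na].
  have c0 i : 0 <= coord Delta i a by apply: natr_ge0.
  have h0 : height Delta a != 0.
    by apply: contraNneq a0 => /(coord_height0 c0) ->.
  split=> //; rewrite lt_def h0 sumr_ge0 //; by apply/forallP.
have c0 i : 0 <= coord Delta i (- a) by rewrite linearN /= natr_ge0.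
have h0 : height Delta a != 0.
  apply: contraNneq a0 => h0; rewrite -oppr_eq0; apply/eqP/(coord_height0 c0).
  by rewrite linearN /= h0 oppr0.
have hle : height Delta a <= 0.
  by rewrite -oppr_ge0 -linearN; apply: sumr_ge0.
split=> //; rewrite ltNge hle; apply/negP => /forallP ca.
by move/eqP: h0; apply; apply/eqP; rewrite eq_le hle sumr_ge0.
Qed.

Lemma positive_rootsE : pos_part (undup Phi) (height Delta)
  =i positive_roots Phi Delta.
Proof.
move=> a; rewrite mem_filter mem_undup.
have [aP|aP] := boolP (a \in Phi); last first.
  by rewrite andbF mem_filter (negPf aP) andbF.
by rewrite andbT (root_height aP).2.
Qed.

Lemma positive_root_ht a : a \in positive_roots Phi Delta ->
  [/\ a \in Phi, height Delta a = (ht Delta a)%:R & (0 < ht Delta a)%N].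
Proof.
move=> ap; have /[!mem_filter] /andP[/forallP a0 aP] := ap.
have htE : height Delta a = (ht Delta a)%:R.
  rewrite /height /ht natr_sum; apply: eq_bigr => i _; rewrite truncnK //.
  have [_ _ /(_ a aP)[->//|/(_ i) na]] := sDelta.
  suff -> : coord Delta i a = 0 by apply: (natr_nat _ 0).
  by apply/eqP; rewrite eq_le a0 -oppr_ge0 natr_ge0.
by split=> //; rewrite -(ltr0n R) -htE -(root_height aP).2.
Qed.

Lemma simple_indecomposable a : a \in Delta ->
  indecomposable (undup Phi) (height Delta) a /\ height Delta a = 1.
Proof.
move=> aD; have [basisD subD _] := sDelta.
have ha : height Delta a = 1.
  have /tnthP[j ->] := aD; rewrite /height (bigD1 j) //= big1 => [|i ij].
    by rewrite (tnth_nth 0) coord_free ?(basis_free basisD) // eqxx addr0.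
  by rewrite (tnth_nth 0) coord_free ?(basis_free basisD) // eq_sym (negPf ij).
split=> //; apply/andP; split.
  by apply/pos_partP; rewrite mem_undup subD //= ha.
apply/allP => b; rewrite positive_rootsE => /positive_root_ht[_ hb b0].
apply/pos_partP => -[_]; rewrite linearB /= ha hb subr_gt0.
by rewrite ltrn1 ltnNge b0.
Qed.

Lemma sum_cartan_height v :
  \sum_(b <- pos_part (undup Phi) (height Delta)) cartan v b
    = 2 * height Delta v.
Proof.
have [/span_basis Dspan _ _] := sDelta.
have f0 : {in undup Phi, forall a, height Delta a != 0}.
  by move=> a; rewrite mem_undup => /root_height[].
have vD : v \in <<Delta>>%VS by rewrite Dspan memvf.
have := sum_cartan_span undup_reflection_system f0 simple_indecomposable vD.
by rewrite mul1r.
Qed.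

End RootSystem.

(** * Induction on the height *)

Section HeightInduction.
Variables (Phi : seq V) (Delta : l.-tuple V) (I : seq V).
Hypotheses (rPhi : is_root_system Phi) (sDelta : is_simple_system Phi Delta).
Hypotheses (uI : uniq I) (Ipos : {subset I <= positive_roots Phi Delta}).
Notation m := (max_height Delta I).
Hypothesis Ilow : forall h b, (h < m)%N -> b \in positive_roots Phi Delta ->
  (ht Delta b <= h)%N -> b \in I.

(** With [l] as the number of roots of height [0], the multiplicity of the
    exponent [0] obeys the same rule as the others. *)
Definition level_count j := if j == 0%N then l else height_count Delta I j.

(** The multiplicity of the exponent [j] when only the roots of height at most
    [h] are present. *)
Definition multiplicity h j : nat :=
  if (j < h)%N then (level_count j - level_count j.+1)%N
  else if j == h then level_count h else 0%N.

Definition up_to h : seq V := [seq a <- I | (ht Delta a <= h)%N].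

Definition free_up_to h := exists theta (e : 'I_l -> nat),
  [/\ is_basis_D (root_arrangement (up_to h)) theta,
      forall i, homogeneous_der (e i) (theta i),
      forall j, #|[set i | e i == j]| = multiplicity h j
    & forall j, (j < h)%N -> (level_count j.+1 <= level_count j)%N].

Lemma I_height a : a \in I ->
  [/\ a \in undup Phi, height Delta a = (ht Delta a)%:R & (0 < ht Delta a)%N].
Proof.
by move=> /Ipos/(positive_root_ht rPhi sDelta)[]; rewrite mem_undup.
Qed.

Lemma free_up_to0 : free_up_to 0.
Proof.
exists (@mderiv l R), (fun=> 0%N); split=> [|i|j|//].
- rewrite (_ : up_to 0 = [::]); first exact: basis_D_nil.
  apply/eqP; rewrite -[_ == _]negbK -has_filter.
  apply/hasPn => a /I_height[_ _].
  by rewrite leqn0 lt0n.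
- apply/homogeneous_derP => a; rewrite mderiv_lform -alg_mpolyC.
  exact/rpredZ/dhomog1.
- rewrite /multiplicity ltn0 eq_sym; case: (j == 0%N); last first.
    by apply/eqP; rewrite cards_eq0; apply/eqP/setP => i; rewrite !inE.
  by rewrite (_ : [set _ | _] = setT) ?cardsT ?card_ord.
Qed.

Lemma free_up_to_succ h : (h < m)%N -> free_up_to h -> free_up_to h.+1.
Proof.
move=> hm [theta0 [e [basis0 hom0 e_mult count_le]]].
have sys := undup_reflection_system rPhi.
have f0 : {in undup Phi, forall a, height Delta a != 0}.
  by move=> a; rewrite mem_undup => /(root_height rPhi sDelta)[].
pose N := [seq a <- I | ht Delta a == h.+1].
have NP a : a \in N -> [/\ a \in I, a \in undup Phi & height Delta a = h.+1%:R].
  by rewrite mem_filter => /andP[/eqP <- aI]; have [] := I_height aI.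
have TP a : a \in up_to h ->
    [/\ a \in I, a \in undup Phi & 0 < height Delta a < h.+1%:R].
  rewrite mem_filter => /andP[ah aI]; have [aP -> a0] := I_height aI.
  by rewrite ltr0n a0 ltr_nat ltnS ah.
have uN : uniq N by apply: filter_uniq.
have subN : {subset N <= undup Phi} by move=> a /NP[].
have hN : {in N, forall a, height Delta a = h.+1%:R} by move=> a /NP[].
have eh i : (e i <= h)%N.
  rewrite leqNgt; apply/negP => hi.
  have /eqP := e_mult (e i); rewrite /multiplicity.
  rewrite [(e i < h)%N]ltnNge (ltnW hi) (gtn_eqF hi) /=.
  by rewrite cards_eq0 => /eqP/setP/(_ i); rewrite !inE eqxx.
have [x [Nx Tx]] : exists x, {in N, forall a, dot a x = 0} /\
    {in up_to h, forall g, dot g x != 0}.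
  apply: point_off_hyperplanes => g /TP[_ gP /andP[g0 gh]].
  apply: contraTN gh => gN; rewrite -leNgt.
  by apply: (level_lowest sys f0 uN subN _ hN gP gN) => //; rewrite ltr0n.
have bound : {in N, forall a, value_bound (up_to h) h a}.
  move=> a aN; have [aI aP ha] := NP a aN.
  have ap : a \in pos_part (undup Phi) (height Delta).
    by apply/pos_partP; rewrite /= ha ltr0n.
  have hb : 2 * h%:R
      <= \sum_(b <- pos_part (undup Phi) (height Delta)) cartan a b - 2.
    by rewrite sum_cartan_height // ha -[h.+1]addn1 natrD; lra.
  apply: value_bound_eq_mem (value_bound_root sys f0 ap hb) => g.
  rewrite mem_filter positive_rootsE // [RHS]mem_filter /= ha.
  apply/andP/andP => -[gh].
    move=> gp; have [_ hg _] := positive_root_ht rPhi sDelta gp.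
    have {}gh : (ht Delta g <= h)%N by rewrite -ltnS -(ltr_nat R) -hg.
    by split=> //; apply: Ilow gp gh.
  by move=> gI; have [_ -> _] := I_height gI; rewrite ltr_nat ltnS gh Ipos.
have T0 : 0 \notin up_to h.
  by apply/negP => /TP[_ /(root_neq0 sys)]; rewrite eqxx.
have TN : up_to h.+1 =i up_to h ++ N.
  move=> a; rewrite mem_cat !mem_filter -andb_orl; congr (_ && _).
  by rewrite leq_eqVlt ltnS orbC.
have freeN : free N by apply: (level_free sys f0 uN subN _ hN); rewrite ltr0n.
have [theta [P [cardP Pe basis hom]]] :=
  multiple_addition T0 freeN TN Nx Tx bound eh basis0 hom0.
have cardN : size N = level_count h.+1 by rewrite size_filter.
have Psub : P \subset [set i | e i == h].
  by apply/subsetP => i /Pe; rewrite inE => /eqP.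
have e_h : #|[set i | e i == h]| = level_count h.
  by rewrite e_mult /multiplicity ltnn eqxx.
have level_le : (level_count h.+1 <= level_count h)%N.
  by rewrite -cardN -cardP -e_h subset_leq_card.
exists theta, (fun i => e i + (i \in P))%N; split=> // j; last first.
  by rewrite ltnS leq_eqVlt => /predU1P[-> | /count_le].
rewrite /multiplicity ltnS; have [jh|hj|->] := ltngtP j h.
- have := e_mult j; rewrite /multiplicity jh => <-; congr #|pred_of_set _|.
  apply/setP => i; rewrite !inE; have [iP|iP] := boolP (i \in P); last first.
    by rewrite /= addn0.
  by rewrite Pe //= addn1 !gtn_eqF // ltnW.
- have [->|jh] := eqVneq j h.+1.
    rewrite -cardN -cardP; congr #|pred_of_set _|.
    apply/setP => i; rewrite !inE; have [iP|iP] := boolP (i \in P).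
      by rewrite Pe //= addn1 eqxx.
    by rewrite /= addn0 ltn_eqF // ltnS.
  apply/eqP; rewrite cards_eq0; apply/eqP/setP => i; rewrite !inE.
  have hj1 : (h.+1 < j)%N by rewrite ltn_neqAle eq_sym jh.
  rewrite ltn_eqF // (leq_ltn_trans _ hj1) //.
  by rewrite -addn1 leq_add // leq_b1.
- rewrite -e_h -cardN -cardP -(cardsID P [set i | e i == h]) (setIidPr Psub).
  rewrite addKn; congr #|pred_of_set _|.
  apply/setP => i; rewrite !inE; have [iP|iP] := boolP (i \in P).
    by rewrite Pe //= addn1 gtn_eqF.
  by rewrite /= addn0.
Qed.

Lemma free_up_to_max : free_up_to m.
Proof.
suff main h : (h <= m)%N -> free_up_to h by apply: main.
elim: h => [_|h IHh hm]; first exact: free_up_to0.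
exact/free_up_to_succ/IHh/ltnW.
Qed.

Lemma count_dual_partition j : (0 < m)%N ->
  count_mem j (dual_partition Delta I) = multiplicity m j.
Proof.
move=> m0; rewrite /dual_partition !count_cat !count_nseq count_flatten.
rewrite sumnE !big_map /= /multiplicity.
under eq_bigr do rewrite count_nseq /=.
have [->|j0] := eqVneq j 0%N.
  rewrite m0 /level_count /= (gtn_eqF m0) mul0n addn0 mul1n.
  rewrite big_seq big1 ?addn0 // => i.
  by rewrite mem_iota => /andP[/gtn_eqF ->].
rewrite mul0n add0n.
have lcE i : i != 0%N -> level_count i = height_count Delta I i.
  by rewrite /level_count => /negPf ->.
have midE : (\sum_(k <- iota 1 m.-1) (k == j)
    * (height_count Delta I k - height_count Delta I k.+1)
    = (j < m) * (level_count j - level_count j.+1))%N.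
  rewrite !lcE //; have [jm|jm] := ltnP j m.
    rewrite (bigD1_seq j) ?iota_uniq //= ?mem_iota ?lt0n ?j0 ?add1n ?prednK //.
    by rewrite eqxx big1 ?addn0 // => k /negPf ->.
  rewrite big_seq big1 // => k; rewrite mem_iota add1n prednK // => /andP[_ km].
  by rewrite (ltn_eqF (leq_trans km jm)).
rewrite midE [m == j]eq_sym; case: ltngtP => [jm|_|->].
- by rewrite mul1n mul0n addn0.
- by rewrite !mul0n.
- by rewrite mul0n mul1n lcE // -lt0n.
Qed.

End HeightInduction.

End Height.

Theorem corollary1p3 (R : realType) (l : nat)
    (Phi : seq 'rV[R]_l) (Delta : l.-tuple 'rV[R]_l) (beta : seq 'rV[R]_l) :
  is_root_system Phi ->
  is_irreducible Phi ->
  is_simple_system Phi Delta ->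
  uniq beta ->
  beta =i positive_roots Phi Delta ->
  sorted (fun a b => (ht Delta a <= ht Delta b)%N) beta ->
  forall t : nat, (1 <= t <= size beta)%N ->
    dual_partition_defined Delta (take t beta) /\
    free_with_exponents (root_arrangement (take t beta))
                        (dual_partition Delta (take t beta)).
Proof.
move=> rPhi _ sDelta ubeta betaE sbeta t /andP[t0 tn].
set I := take t beta; pose m := max_height Delta I.
have uI : uniq I by apply: take_uniq.
have Ipos : {subset I <= positive_roots Phi Delta}.
  by move=> a /mem_take; rewrite betaE.
have Ilow h b : (h < m)%N -> b \in positive_roots Phi Delta ->
    (ht Delta b <= h)%N -> b \in I.
  rewrite -betaE -{1}(cat_take_drop t beta) mem_cat => hm /orP[//|bd] bh.
  move: sbeta; rewrite sorted_pairwise; last first.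
    by move=> u v w; apply: leq_trans.
  rewrite -(cat_take_drop t beta) pairwise_cat => /andP[/allrelP ab _].
  suff : (m <= h)%N by rewrite leqNgt hm.
  by apply/bigmax_leqP_seq => a aI _; apply: leq_trans (ab a b aI bd) bh.
have m0 : (0 < m)%N.
  have [a aI] : exists a, a \in I.
    have : (0 < size I)%N by rewrite size_take_min leq_min t0 (leq_trans t0).
    by case: (I) => // a s _; exists a; rewrite mem_head.
  have [_ _ ha] := positive_root_ht rPhi sDelta (Ipos a aI).
  by apply: leq_trans ha _; apply: (leq_bigmax_seq (F := ht Delta)).
have up_toI : up_to Delta I m = I.
  apply/all_filterP/allP => a aI.
  by apply: (leq_bigmax_seq (F := ht Delta)).
have [theta [e [basis hom e_mult count_le]]] :=
  free_up_to_max rPhi sDelta uI Ipos Ilow.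
rewrite -/m up_toI in basis; split.
  split=> [|j /andP[j0 jm]]; first exact: count_le 0%N m0.
  by have := count_le j jm; rewrite /level_count (gtn_eqF j0).
split=> [_ /mapP[a aI ->]|].
  apply: dim_hyperplane_of.
  have [aP _ _] := positive_root_ht rPhi sDelta (Ipos a aI).
  by case: rPhi => _ Phi0 _ _ _; apply: contraNneq Phi0 => <-.
exists theta, [tuple e i | i < l]; split=> // [i|].
  by rewrite tnth_mktuple.
apply/allP => j _ /=; rewrite count_dual_partition // -e_mult.
by rewrite count_map -sum1_count -sum1dep_card big_enum_cond.
Qed.
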